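(* Let $Q\subset\mathbb{R}^2$ be any trapezoid and let $T\subset\mathbb{R}^2$ be any convex body. Then Viterbo's conjecture holds for the Lagrangian product $Q\times T\subset\mathbb{R}^2(x)\times\mathbb{R}^2(y)=\mathbb{R}^4$, i.e. $$\mathrm{vol}(Q\times T)\;\ge\;\frac{c_{EHZ}(Q\times T)^2}{2}.$$
   Context: Identify $\mathbb{R}^4=\mathbb{R}^2(x)\times\mathbb{R}^2(y)$ with coordinates $(x_1,x_2,y_1,y_2)$ and the standard symplectic form $\omega=dx_1\wedge dy_1+dx_2\wedge dy_2$. Let $J=\begin{pmatrix}0&I_2\\-I_2&0\end{pmatrix}$. A convex body is a compact convex set with nonempty interior. For a convex body $C\subset\mathbb{R}^4$ with $0$ in its interior let $\mu_C(z)=\min\{t\ge 0: z\in tC\}$ be its gauge and $\partial\mu_C$ its subdifferential. A closed characteristic on $\partial C$ is an absolutely continuous loop $x:\mathbb{R}/\mathbb{Z}\to\mathbb{R}^4$ with $\mu_C(x(t))=1$ for all $t$ and $\dot x(t)\in\mathbb{R}_{>0}\,J\,\partial\mu_C(x(t))$ for almost every $t$; its action is $\mathbb{A}(x)=-\frac12\int_0^1\langle J\dot x(t),x(t)\rangle\,dt$. The EHZ-capacity is $c_{EHZ}(C)=\min\{\mathbb{A}(x): x \text{ closed characteristic on }\partial C\}$; it is translation invariant, which defines it for every convex body in $\mathbb{R}^4$. $\mathrm{vol}$ denotes Lebesgue measure (area in $\mathbb{R}^2$, 4-volume in $\mathbb{R}^4$). A trapezoid is a convex quadrilateral in $\mathbb{R}^2$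 with at least one pair of parallel sides; triangles are also counted as (degenerate) trapezoids. *)

(* Defs.v *)
From HB Require Import structures.
From mathcomp Require Import all_boot all_order all_algebra.
From mathcomp Require Import all_classical all_reals all_analysis.
Set Implicit Arguments. Unset Strict Implicit. Unset Printing Implicit Defensive.
Import Order.TTheory GRing.Theory Num.Theory.
Import numFieldNormedType.Exports.
Local Open Scope classical_set_scope.
Local Open Scope ring_scope.

Section Defs.
Variable R : realType.

(* R^2 = R * R ; R^4 = R^2(x) * R^2(y), a point is ((x1,x2),(y1,y2)) *)
Definition pt2 := (R * R)%type.
Definition pt4 := (pt2 * pt2)%type.

Definition add2 (p q : pt2) : pt2 := (p.1 + q.1, p.2 + q.2).
Definition scale2 (t : R) (p : pt2) : pt2 := (t * p.1, t * p.2).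

Definition convex2 (C : set pt2) : Prop :=
  forall p q t, C p -> C q -> 0 <= t <= 1 ->
    C (add2 (scale2 t p) (scale2 (1 - t) q)).

Definition convex_body2 (C : set pt2) : Prop :=
  compact C /\ convex2 C /\ interior C !=set0.

Definition conv4 (a b c d : pt2) : set pt2 :=
  [set p | exists ta tb tc td : R,
     [/\ 0 <= ta, 0 <= tb, 0 <= tc, 0 <= td & ta + tb + tc + td = 1] /\
     p = add2 (add2 (scale2 ta a) (scale2 tb b))
              (add2 (scale2 tc c) (scale2 td d))].

(* trapezoid: conv{a,b,c,d} with nonempty interior, where the sides [a,b]
   and [d,c] are parallel: c - d = lam (b - a), lam >= 0.  lam > 0 gives a
   (nondegenerate) trapezoid with vertices a,b,c,d in cyclic order; lam = 0
   (c = d) gives the triangle abd (degenerate trapezoids). *)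
Definition trapezoid (Q : set pt2) : Prop :=
  exists (a b c d : pt2) (lam : R),
    0 <= lam /\
    c.1 - d.1 = lam * (b.1 - a.1) /\ c.2 - d.2 = lam * (b.2 - a.2) /\
    Q = conv4 a b c d /\ interior Q !=set0.

Definition ip4 (z w : pt4) : R :=
  z.1.1 * w.1.1 + z.1.2 * w.1.2 + z.2.1 * w.2.1 + z.2.2 * w.2.2.

Definition J4 (z : pt4) : pt4 := (z.2, (- z.1.1, - z.1.2)).

Definition scale4 (t : R) (z : pt4) : pt4 :=
  ((t * z.1.1, t * z.1.2), (t * z.2.1, t * z.2.2)).
Definition sub4 (z w : pt4) : pt4 :=
  ((z.1.1 - w.1.1, z.1.2 - w.1.2), (z.2.1 - w.2.1, z.2.2 - w.2.2)).

Definition translate4 (C : set pt4) (z0 : pt4) : set pt4 :=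
  [set sub4 z z0 | z in C].

Definition gauge (C : set pt4) (z : pt4) : R :=
  inf [set t : R | 0 <= t /\ exists c, C c /\ z = scale4 t c].

Definition subdiff_gauge (C : set pt4) (z : pt4) : set pt4 :=
  [set v | forall w, gauge C z + ip4 v (sub4 w z) <= gauge C w].

Definition abs_cont (a b : R) (f : R -> R) : Prop :=
  forall eps : R, 0 < eps -> exists2 delta : R, 0 < delta &
    forall (n : nat) (u v : 'I_n -> R),
      (forall i, a <= u i /\ u i <= v i /\ v i <= b) ->
      (forall i j, i != j -> v i <= u j \/ v j <= u i) ->
      \sum_(i < n) (v i - u i) < delta ->
      \sum_(i < n) `|f (v i) - f (u i)| < eps.

Definition comp4 (x : R -> pt4) : seq (R -> R) :=
  [:: (fun t => (x t).1.1); (fun t => (x t).1.2);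
      (fun t => (x t).2.1); (fun t => (x t).2.2)].

(* a loop R/Z -> R^4 is a 1-periodic map R -> R^4; it is absolutely
   continuous iff each coordinate is absolutely continuous on [0,1] *)
Definition ac_loop (x : R -> pt4) : Prop :=
  (forall t, x (t + 1) = x t) /\ (forall f, f \in comp4 x -> abs_cont 0 1 f).

Definition loop_derivable (x : R -> pt4) (t : R) : Prop :=
  forall f, f \in comp4 x -> derivable f t 1.

Definition dot4 (x : R -> pt4) (t : R) : pt4 :=
  ((derive1 (fun s => (x s).1.1) t, derive1 (fun s => (x s).1.2) t),
   (derive1 (fun s => (x s).2.1) t, derive1 (fun s => (x s).2.2) t)).

(* closed characteristic on the boundary of C (0 in the interior of C) *)
Definition closed_characteristic (C : set pt4) (x : R -> pt4) : Prop :=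
  ac_loop x /\
  (forall t, gauge C (x t) = 1) /\
  exists N, (@lebesgue_measure R).-negligible N /\
    forall t, `[0, 1]%classic t -> ~ N t ->
      loop_derivable x t /\
      exists lam : R, exists v : pt4,
        0 < lam /\ subdiff_gauge C (x t) v /\ dot4 x t = scale4 lam (J4 v).

Definition action (x : R -> pt4) : R :=
  - (1 / 2) * Rintegral (@lebesgue_measure R) `[0, 1]%classic
                (fun t => ip4 (J4 (dot4 x t)) (x t)).

(* c is the EHZ capacity of the convex body K: computed after translating
   an interior point z0 of K to the origin (translation invariance). *)
Definition is_cEHZ (K : set pt4) (c : R) : Prop :=
  exists z0, interior K z0 /\
    (exists x, closed_characteristic (translate4 K z0) x /\ action x = c) /\
    (forall x, closed_characteristic (translate4 K z0) x -> c <= action x).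

Definition area : set pt2 -> \bar R :=
  ((@lebesgue_measure R) \x (@lebesgue_measure R))%E.
Definition vol4 : set pt4 -> \bar R := (area \x area)%E.

End Defs.

(* Main.v *)
Require Import Defs.
From HB Require Import structures.
From mathcomp Require Import all_boot all_order all_algebra.
From mathcomp Require Import all_classical all_reals all_analysis.
From mathcomp Require Import measurable_realfun real_interval ring lra.
Set Implicit Arguments. Unset Strict Implicit. Unset Printing Implicit Defensive.
Import Order.TTheory GRing.Theory Num.Theory.
Import numFieldNormedType.Exports.
Local Open Scope classical_set_scope.
Local Open Scope ring_scope.

(* If e = b - a and f = d - a span the plane, an affine symplectic change of
   coordinates replaces Q by U = {0 <= y <= 1, 0 <= x, x + k y <= 1} with
   0 <= k <= 1 and T by its image under p |-> (<e,p>, <f,p>), without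
   changing vol(Q) vol(T).

   Polygons (q_i) in Q and (p_i) in T with q_(i+1) - q_i normal to T at p_i
   and p_i - p_(i+1) normal to Q at q_(i+1) yield a closed characteristic of
   action sum <q_(i+1) - q_i, p_i>.  Such pairs come from inscribed copies:
   for a figure {0, r1, r2}, a largest copy s.{0, r1, r2} + p contained in T
   carries normals of T at its vertices with sum zero (separation in R^2 x R^2),
   and these normals are the sides of the polygon (q_i).  Let L be the longest
   vertical chord of T and let s, t be the sizes of the largest copies of the
   triangles with vertices 0, (0, k) and (-1, 0), respectively (1, k).  The
   polygon attached to the smallest of L, s, t can be placed inside U: if it
   stuck out, it would be longer than a competitor by weak duality.  Hence
   c <= m := min (L, s, t).

   Finally T contains a vertical chord and two triangles of size m, so by
   concavity of the length of vertical chords area T >= m^2 / (2 - k), while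
   area U = (2 - k) / 2. *)

(** * Integrals of step functions *)

Section StepIntegral.
Variable R : realType.
Let mu := @lebesgue_measure R.

(** The hypothesis avoids the end points because the derivative of a polygonal loop is only
    controlled off its corners; half-open intervals keep consecutive pieces disjoint. *)
Lemma integral_itv_const (f : R -> R) (a b c : R) : a < b ->
  (forall t, a < t < b -> f t = c) ->
  measurable_fun `]a, b] f /\
  (\int[mu]_(t in `]a, b]) (f t)%:E = ((b - a) * c)%:E)%E.
Proof.
move=> ab fc.
have mf : measurable_fun `]a, b[ f.
  apply: (eq_measurable_fun (cst c)); last exact: measurable_cst.
  by move=> t; rewrite inE/= in_itv/= => tab; rewrite fc.
split; first exact: (@measurable_realfun.measurable_fun_itv_oc _ a b false true).
have mfE : measurable_fun `]a, b[ (fun t : R => (f t)%:E) by exact/measurable_EFinP.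
rewrite (integral_itv_bndoo _ _ mfE).
under eq_integral.
  move=> t; rewrite inE/= in_itv/= => tab; rewrite fc//; over.
rewrite integral_cst//= lebesgue_measure_itv/= lte_fin ab -EFinB -EFinM.
by rewrite mulrC.
Qed.

Lemma integral_step (f : R -> R) (d : nat -> R) (w : R) (N : nat) : 0 < w ->
  (forall i t, (i < N)%N -> i%:R * w < t < i.+1%:R * w -> f t = d i) ->
  measurable_fun `[0, N%:R * w] f /\
  (\int[mu]_(t in `[0%R, (N%:R * w)%R]) (f t)%:E =
    (\sum_(i < N) w * d i)%:E)%E.
Proof.
move=> w0; elim: N => [|N IH] H.
  rewrite mul0r big_ord0 set_itv1; split; first exact: measurable_fun_set1.
  by rewrite integral_set1.
have [i t iN|mf IN] := IH; first by apply: H; rewrite ltnS ltnW.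
have ltw : N%:R * w < N.+1%:R * w by rewrite ltr_pM2r// ltr_nat.
have [t ht|mf' I'] := @integral_itv_const f (N%:R * w) (N.+1%:R * w) (d N) ltw.
  exact: H.
have E : `[0, N.+1%:R * w]%classic =
    (`[0, N%:R * w] `|` `]N%:R * w, N.+1%:R * w])%classic.
  apply: itv_bndbnd_setU; last by rewrite bnd_simp ltW.
  by rewrite bnd_simp mulr_ge0// ltW.
have mU : measurable_fun `[0, N.+1%:R * w] f by rewrite E measurable_funU.
split => //; rewrite E in mU *.
rewrite integral_setU//; last 2 first.
- exact/measurable_EFinP.
- apply/disj_setPS => t [/=]; rewrite !in_itv/= => /andP[_ h1] /andP[h2 _].
  by move: (lt_le_trans h2 h1); rewrite ltxx.
rewrite IN I' -EFinD big_ord_recr/=; congr (_ + _)%:E; ring.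
Qed.

End StepIntegral.

(** * Polygonal loops *)

Section PolygonalLoop.
Variable R : realType.
Implicit Types (z : nat -> R) (N : nat) (t s : R).

Definition clamp01 (s : R) : R := Num.max 0 (Num.min 1 s).

Lemma clamp01_ge1 s : 1 <= s -> clamp01 s = 1.
Proof. by rewrite /clamp01 => h; rewrite min_l// max_r. Qed.

Lemma clamp01_le0 s : s <= 0 -> clamp01 s = 0.
Proof.
by rewrite /clamp01 => h; rewrite min_r ?max_l// (le_trans h).
Qed.

Lemma clamp01_id s : 0 <= s <= 1 -> clamp01 s = s.
Proof. by rewrite /clamp01 => /andP[? ?]; rewrite min_r// max_r. Qed.

Lemma clamp01_lip s t : `|clamp01 s - clamp01 t| <= `|s - t|.
Proof.
have H (x y : R) : x <= y -> `|clamp01 x - clamp01 y| <= y - x.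
  move=> xy; rewrite ler_norml /clamp01.
  have [a|a] := leP 1 x; have [b|b] := leP 1 y; have [c|c] := leP 0 x;
  by have [d|d] := leP 0 y; rewrite ?(max_r ler01); lra.
have [st|/ltW ts] := leP s t.
  by rewrite (distrC s t) (ger0_norm (x := t - s)) ?subr_ge0// H.
by rewrite distrC (ger0_norm (x := s - t)) ?subr_ge0// H.
Qed.

(* The polygonal path which is at [z i] at time [i]. *)
Definition polyg z N s : R :=
  z 0%N + \sum_(i < N) clamp01 (s - i%:R) * (z i.+1 - z i).

(** During leg [i] the earlier increments are saturated and telescope, the later ones vanish. The
    first branch covers times after the end of the path. *)
Lemma polyg_leg z N i s : i%:R <= s <= i.+1%:R ->
  polyg z N s = if (N <= i)%N then z N else z i + (s - i%:R) * (z i.+1 - z i).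
Proof.
move=> /andP[h1 h2]; rewrite /polyg.
elim: N => [|N IH]; first by rewrite big_ord0 addr0.
rewrite big_ord_recr/= addrA IH; case: (ltngtP N i) => Ni.
- rewrite clamp01_ge1; first by ring.
  have : (N.+1%:R <= i%:R :> R) by rewrite ler_nat.
  by rewrite -natr1; lra.
- rewrite clamp01_le0 ?mul0r ?addr0//.
  have : (i.+1%:R <= N%:R :> R) by rewrite ler_nat.
  by lra.
- subst i; rewrite clamp01_id//; apply/andP; split; first by lra.
  by move: h2; rewrite -natr1; lra.
Qed.

Lemma polyg_lip z N : exists2 K, 0 <= K & forall s t,
  `|polyg z N s - polyg z N t| <= K * `|s - t|.
Proof.
exists (\sum_(i < N) `|z i.+1 - z i|); first exact: sumr_ge0.
move=> s t; rewrite /polyg opprD addrACA subrr add0r -sumrB mulr_suml.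
apply: le_trans (ler_norm_sum _ _ _) _; apply: ler_sum => i _.
rewrite -mulrBl normrM mulrC ler_wpM2l//.
apply: le_trans (clamp01_lip _ _) _.
by rewrite (_ : s - i%:R - (t - i%:R) = s - t)//; ring.
Qed.

Lemma lip_abs_cont (f : R -> R) (K : R) : 0 <= K ->
  (forall s t, 0 <= s <= 1 -> 0 <= t <= 1 -> `|f s - f t| <= K * `|s - t|) ->
  abs_cont 0 1 f.
Proof.
(* [K + 1] instead of [K] keeps the quotient meaningful when [K = 0]. *)
move=> K0 H eps e0; exists (eps / (K + 1)); first by rewrite divr_gt0//; lra.
move=> n u v h1 _ h3.
apply: (@le_lt_trans _ _ (K * \sum_(i < n) (v i - u i))).
  rewrite mulr_sumr; apply: ler_sum => i _; have [a [b c]] := h1 i.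
  have := H (v i) (u i); rewrite (ger0_norm (x := v i - u i)) ?subr_ge0//.
  by apply; lra.
have S0 : 0 <= \sum_(i < n) (v i - u i).
  by apply: sumr_ge0 => i _; have [a [b c]] := h1 i; lra.
apply: (@le_lt_trans _ _ ((K + 1) * \sum_(i < n) (v i - u i))); first by nra.
by rewrite mulrC -ltr_pdivlMr//; lra.
Qed.

Definition fracpart t : R := t - (Num.floor t)%:~R.

Lemma fracpart_itv t : 0 <= fracpart t < 1.
Proof.
rewrite /fracpart; have := floor_itv t; rewrite intrD => /andP[? ?].
by apply/andP; split; lra.
Qed.

Lemma fracpartD1 t : fracpart (t + 1) = fracpart t.
Proof. by rewrite /fracpart floorDrz// floor1 intrD; ring. Qed.

Lemma fracpart_id t : 0 <= t < 1 -> fracpart t = t.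
Proof. by move=> h; rewrite /fracpart (floor_def (m := 0)) ?subr0. Qed.

Lemma fracpart1 : fracpart 1 = 0.
Proof. by rewrite /fracpart floor1 subrr. Qed.

Definition ploop z N t : R := polyg z N (N%:R * fracpart t).

(** At [t = 1] the fractional part falls back to [0]; the closing condition makes both sides agree
    there. *)
Lemma ploop_itv z N t : z N = z 0%N -> 0 <= t <= 1 ->
  ploop z N t = polyg z N (N%:R * t).
Proof.
move=> zN /andP[t0]; rewrite le_eqVlt => /predU1P[->|t1]; last first.
  by rewrite /ploop fracpart_id// t0.
rewrite /ploop fracpart1 mulr0 mulr1 (@polyg_leg z N 0%N 0); last lra.
rewrite (@polyg_leg z N N N%:R) ?leqnn; last by rewrite lexx ler_nat leqnSn.
by case: N zN => //= N ->; rewrite subrr mul0r addr0.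
Qed.

Lemma ploop_abs_cont z N : z N = z 0%N -> abs_cont 0 1 (ploop z N).
Proof.
move=> zN; have [K K0 HK] := polyg_lip z N.
apply: (@lip_abs_cont _ (K * N%:R)); first by rewrite mulr_ge0.
move=> s t hs ht; rewrite !ploop_itv//; apply: le_trans (HK _ _) _.
by rewrite -mulrBr normrM ger0_norm// mulrA.
Qed.

Lemma ploop_leg z N i t : (i < N)%N -> i%:R <= N%:R * t < i.+1%:R ->
  ploop z N t = z i + (N%:R * t - i%:R) * (z i.+1 - z i).
Proof.
move=> iN /andP[h1 h2].
have iN' : i.+1%:R <= N%:R :> R by rewrite ler_nat.
have i0 : 0 <= i%:R :> R by [].
have N0 : 0 < N%:R :> R by rewrite ltr0n (leq_ltn_trans _ iN).
have h : i%:R <= N%:R * t <= i.+1%:R by apply/andP; split => //; exact: ltW.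
rewrite /ploop fracpart_id; last by apply/andP; split; nra.
by rewrite (polyg_leg z N h) leqNgt iN.
Qed.

Lemma ploop_deriv z N i t : (i < N)%N -> i%:R < N%:R * t < i.+1%:R ->
  is_derive t 1 (ploop z N) (N%:R * (z i.+1 - z i)).
Proof.
move=> iN /andP[h1 h2].
have N0 : 0 < N%:R :> R by rewrite ltr0n (leq_ltn_trans _ iN).
have iN' : i.+1%:R <= N%:R :> R by rewrite ler_nat.
have Nt : t \in `](i%:R / N%:R), (i.+1%:R / N%:R)[.
  by rewrite in_itv/= ltr_pdivrMr// ltr_pdivlMr// mulrC h1.
pose g s : R := z i + (N%:R * s - i%:R) * (z i.+1 - z i).
apply: (@near_eq_is_derive _ _ _ g).
  near=> s.
  have : s \in `](i%:R / N%:R), (i.+1%:R / N%:R)[.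
    by near: s; exact: near_in_itvoo.
  rewrite in_itv/= ltr_pdivrMr// ltr_pdivlMr// => /andP[s1 s2].
  rewrite (@ploop_leg z N i)//; apply/andP; split; last by rewrite mulrC.
  by rewrite mulrC ltW.
rewrite /g; apply: is_derive_eq.
rewrite /GRing.scale/=; ring.
Unshelve. all: by end_near.
Qed.

(** The index and the ratio are found before [z] is quantified, so that one pair serves all four
    coordinates. *)
Lemma ploop_on_leg N t : (0 < N)%N -> exists i r, [/\ (i < N)%N, 0 <= r <= 1 &
  forall z, ploop z N t = z i + r * (z i.+1 - z i)].
Proof.
move=> N0; have /andP[u0 u1] := fracpart_itv t.
have s0 : 0 <= N%:R * fracpart t by rewrite mulr_ge0.
have := truncn_itv s0; set i := Num.trunc _ => /andP[i1 i2].
exists i, (N%:R * fracpart t - i%:R).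
have iN : (i < N)%N.
  rewrite -(ltr_nat R); apply: le_lt_trans i1 _.
  by rewrite gtr_pMr// ltr0n.
split => // [|z']; first by apply/andP; split; [lra|move: i2; rewrite -natr1; lra].
have h : i%:R <= N%:R * fracpart t <= i.+1%:R.
  by apply/andP; split => //; exact: ltW.
by rewrite /ploop (polyg_leg z' N h) leqNgt iN.
Qed.

End PolygonalLoop.

(** * Closed characteristics from polygonal paths *)

Section Legs.
Variable R : realType.
Implicit Types (C : set (pt4 R)) (Z : nat -> pt4 R) (N : nat).

Definition ladd4 (z z' : pt4 R) (r : R) : pt4 R :=
  ((z.1.1 + r * (z'.1.1 - z.1.1), z.1.2 + r * (z'.1.2 - z.1.2)),
   (z.2.1 + r * (z'.2.1 - z.2.1), z.2.2 + r * (z'.2.2 - z.2.2))).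

(** What the gauge needs from an interior origin: the set in its infimum is nonempty. *)
Definition absorbing4 C := forall w, exists t c, [/\ 0 <= t, C c & w = scale4 t c].

Definition convex4 C := forall z z' r, C z -> C z' -> 0 <= r <= 1 ->
  C (ladd4 z z' r).

(* [v] is normalised so that it lies in the subdifferential of the gauge. *)
Definition char_leg C (z z' : pt4 R) := exists c v,
  [/\ 0 < c, sub4 z' z = scale4 c (J4 v), forall w, C w -> ip4 v w <= 1,
      ip4 v z = 1 & ip4 v z' = 1].

Lemma gauge_ge C v w : absorbing4 C -> (forall w, C w -> ip4 v w <= 1) ->
  ip4 v w <= gauge C w.
Proof.
move=> aC vC; apply: lb_le_inf.
  by have [t [c [t0 Cc ->]]] := aC w; exists t; split => //; exists c.
move=> t /= [t0 [c [Cc ->]]]; have := vC _ Cc.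
have -> : ip4 v (scale4 t c) = t * ip4 v c by rewrite /ip4 /scale4/=; ring.
nra.
Qed.

(** The functional [ip4 v] lies below the gauge everywhere and touches it at [z], hence is a
    subgradient there. *)
Lemma gauge_support C v z : absorbing4 C -> (forall w, C w -> ip4 v w <= 1) ->
  C z -> ip4 v z = 1 -> gauge C z = 1 /\ subdiff_gauge C z v.
Proof.
move=> aC vC Cz vz.
have g1 : gauge C z = 1.
  apply/eqP; rewrite eq_le -{2}vz gauge_ge// andbT; apply: ge_inf.
    by exists 0 => t [].
  split => //; exists z; split => //; rewrite /scale4 !mul1r.
  by case: z {Cz vz} => -[? ?] [? ?].
split => // w; rewrite g1 -vz.
have -> : ip4 v z + ip4 v (sub4 w z) = ip4 v w by rewrite /ip4 /sub4/=; ring.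
exact: gauge_ge.
Qed.

Definition ploop4 Z N (t : R) : pt4 R :=
  ((ploop (fun i => (Z i).1.1) N t, ploop (fun i => (Z i).1.2) N t),
   (ploop (fun i => (Z i).2.1) N t, ploop (fun i => (Z i).2.2) N t)).

Lemma ploop4_deriv Z N i t : (i < N)%N -> i%:R < N%:R * t < i.+1%:R ->
  loop_derivable (ploop4 Z N) t /\
  dot4 (ploop4 Z N) t = scale4 N%:R (sub4 (Z i.+1) (Z i)).
Proof.
move=> iN it; have dd z : derivable (ploop z N) t 1.
  by have [] := ploop_deriv z iN it.
split.
  move=> f; rewrite /comp4 !inE => /or4P[] /eqP->;
  exact: dd.
rewrite /dot4 !derive1E /scale4 /sub4/=.
have dv z : 'D_1 (ploop z N) t = N%:R * (z i.+1 - z i).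
  by have [] := ploop_deriv z iN it.
by congr (_, _, (_, _)); exact: dv.
Qed.

(** [ip4 v] equals [1] at both ends of a leg, hence along it, and convexity keeps the leg in [C]; so
    one [v] is a subgradient all along the leg, and the velocity is a positive multiple of
    [J4 v]. *)
Lemma legs_closed_characteristic C Z N : (0 < N)%N -> Z N = Z 0%N ->
  absorbing4 C -> convex4 C -> (forall i, C (Z i)) ->
  (forall i, (i < N)%N -> char_leg C (Z i) (Z i.+1)) ->
  exists x, closed_characteristic C x /\
    action x = - (1 / 2) * \sum_(i < N) ip4 (J4 (sub4 (Z i.+1) (Z i))) (Z i).
Proof.
move=> N0 ZN aC cC CZ legs; exists (ploop4 Z N).
have N0' : 0 < N%:R :> R by rewrite ltr0n.
have on_leg t i r : (forall z, ploop z N t = z i + r * (z i.+1 - z i)) ->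
    ploop4 Z N t = ladd4 (Z i) (Z i.+1) r.
  by move=> H; rewrite /ploop4 !H.
have supp t i r : (i < N)%N -> 0 <= r <= 1 ->
    (forall z, ploop z N t = z i + r * (z i.+1 - z i)) ->
    exists c v, [/\ 0 < c, sub4 (Z i.+1) (Z i) = scale4 c (J4 v),
      gauge C (ploop4 Z N t) = 1 & subdiff_gauge C (ploop4 Z N t) v].
  move=> iN r01 H; have [c [v [c0 Zc vC vz vz']]] := legs i iN.
  exists c, v; rewrite (on_leg _ _ _ H).
  have vr : ip4 v (ladd4 (Z i) (Z i.+1) r) = 1.
    have -> : ip4 v (ladd4 (Z i) (Z i.+1) r) =
        (1 - r) * ip4 v (Z i) + r * ip4 v (Z i.+1).
      by rewrite /ip4 /ladd4/=; ring.
    by rewrite vz vz'; ring.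
  by have [] := gauge_support aC vC (cC _ _ _ (CZ i) (CZ i.+1) r01) vr.
split; last first.
  rewrite /action; congr (_ * _).
  (* The constant value of the integrand on leg [i]: the position differs from [Z i] by a multiple
     of the velocity [u], and [ip4 (J4 u) u = 0]. *)
  pose d i := ip4 (J4 (scale4 N%:R (sub4 (Z i.+1) (Z i)))) (Z i).
  have := @integral_step R (fun t => ip4 (J4 (dot4 (ploop4 Z N) t)) (ploop4 Z N t))
    d (N%:R^-1) N.
  rewrite invr_gt0 mulfV ?gt_eqF// => /(_ N0') [i t iN|_ I].
    rewrite !ltr_pdivrMr// !ltr_pdivlMr// (mulrC t) => it.
    have [_ ->] := @ploop4_deriv Z N i t iN it.
    have it' : i%:R <= N%:R * t < i.+1%:R by case/andP: it => /ltW -> ->.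
    rewrite /ploop4 !(ploop_leg _ iN it') /d /ip4 /J4 /scale4 /sub4/=; ring.
  rewrite /Rintegral I/=; apply: eq_bigr => i _.
  rewrite /d /ip4 /J4 /scale4/=; field.
  by rewrite gt_eqF.
split; [split|split].
- by move=> t; rewrite /ploop4 /ploop !fracpartD1.
- move=> f; rewrite /comp4 !inE => /or4P[] /eqP-> /=;
  by apply: ploop_abs_cont; rewrite ZN.
- move=> t; have [i [r [iN r01 H]]] := ploop_on_leg t N0.
  by have [c [v []]] := supp t i r iN r01 H.
(* The corner times form the exceptional null set; the index [N] removes [t = 1]. *)
- exists (range (fun i : nat => i%:R / N%:R)); split.
    have cA : countable (range (fun i : nat => i%:R / N%:R : R)).
      exact: card_image_le.
    apply/negligibleP; last exact: countable_lebesgue_measure0.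
    by apply: countable_measurable => //= r; exact: measurable_set1.
  move=> t; rewrite /= in_itv/= => /andP[t0 t1] Nt.
  have s0 : 0 <= N%:R * t by rewrite mulr_ge0.
  have := truncn_itv s0; set i := Num.trunc _ => /andP[i1 i2].
  have i1' : i%:R < N%:R * t.
    rewrite lt_neqAle i1 andbT; apply/eqP => E; apply: Nt; exists i => //.
    by rewrite E mulrC mulKf// gt_eqF.
  have iN : (i < N)%N.
    by rewrite -(ltr_nat R); apply: lt_le_trans i1' _; nra.
  have it : i%:R < N%:R * t < i.+1%:R by rewrite i1'.
  have [dl de] := @ploop4_deriv Z N i t iN it.
  split => //.
  have r01 : 0 <= N%:R * t - i%:R <= 1.
    by move: i2; rewrite -natr1 => i2; apply/andP; split; lra.
  have [|c [v [c0 Zc g1 sv]]] := supp t i (N%:R * t - i%:R) iN r01.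
    by move=> z; apply: ploop_leg => //; rewrite ltW.
  exists (N%:R * c), v; split; first exact: mulr_gt0.
  by split => //; rewrite de Zc /scale4/= !mulrA.
Qed.

End Legs.

(** * Minkowski billiards *)

Section Billiard.
Variable R : realType.
Implicit Types (C : set (pt4 R)) (Q T : set (pt2 R)) (p q n : pt2 R).

Definition dot2 (p q : pt2 R) : R := p.1 * q.1 + p.2 * q.2.
Definition sub2 (p q : pt2 R) : pt2 R := (p.1 - q.1, p.2 - q.2).

Definition normal_cone T p n := forall x, T x -> dot2 n x <= dot2 n p.

Fixpoint leg_path (r : pt4 R -> pt4 R -> Prop) z s :=
  if s is y :: s' then r z y /\ leg_path r y s' else True.

Fixpoint leg_sum z (s : seq (pt4 R)) : R :=
  if s is y :: s' then ip4 (J4 (sub4 y z)) z + leg_sum y s' else 0.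

(** A constant leg is never a [char_leg], since [ip4 v z = 1] forces a nonzero velocity; it adds
    nothing to the sum and can be deleted. *)
Lemma leg_path_prune C r z s : leg_path (fun a b => C b /\ (a = b \/ r a b)) z s ->
  exists s', [/\ leg_path (fun a b => C b /\ r a b) z s',
    last z s' = last z s & leg_sum z s' = leg_sum z s].
Proof.
elim: s z => [|y s IH] z /=; first by exists [::].
move=> [[Cy [<-|zy]] /IH [s' [s1 s2 s3]]].
  exists s'; split => //; rewrite s3 /ip4 /J4 /sub4/=; ring.
by exists (y :: s'); split => //=; rewrite s3.
Qed.

Lemma leg_path_nth C r z s : C z -> leg_path (fun a b => C b /\ r a b) z s ->
  (forall i, C (nth z (z :: s) i)) /\
  forall i, (i < size s)%N -> r (nth z (z :: s) i) (nth z (z :: s) i.+1).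
Proof.
move=> Cz H.
(* The head varies in the induction while the default of [nth] stays [z]; as [z] lies in [C], so do
   all values beyond the end of the path. *)
have K z' : C z' -> leg_path (fun a b => C b /\ r a b) z' s ->
    (forall i, C (nth z (z' :: s) i)) /\
    forall i, (i < size s)%N -> r (nth z (z' :: s) i) (nth z (z' :: s) i.+1).
  elim: s z' {H} => [|y s IH] z' Cz' /=.
    by split => // -[|i]//=; rewrite nth_nil.
  move=> [[Cy zy] /(IH _ Cy)[h1 h2]]; split=> -[|i] //=.
  by rewrite ltnS; exact: h2.
exact: K Cz H.
Qed.

Lemma leg_sum_nth z s : leg_sum z s =
  \sum_(i < size s) ip4 (J4 (sub4 (nth z (z :: s) i.+1) (nth z (z :: s) i)))
                        (nth z (z :: s) i).
Proof.
have H z' : leg_sum z' s =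
    \sum_(i < size s) ip4 (J4 (sub4 (nth z (z' :: s) i.+1) (nth z (z' :: s) i)))
                        (nth z (z' :: s) i).
  elim: s z' => [|y s IH] z'; first by rewrite big_ord0.
  by rewrite big_ord_recl /= IH.
exact: H.
Qed.

Lemma leg_path_closed_characteristic C z s : absorbing4 C -> convex4 C -> C z ->
  leg_path (fun a b => C b /\ (a = b \/ char_leg C a b)) z s -> last z s = z ->
  leg_sum z s != 0 ->
  exists x, closed_characteristic C x /\ action x = - (1 / 2) * leg_sum z s.
Proof.
move=> aC cC Cz /leg_path_prune[s' [ps' ls' <-]] zs s0.
have [Cs rs] := leg_path_nth Cz ps'.
(* A nonzero sum guarantees that at least one leg survives the pruning. *)
have s'0 : (0 < size s')%N by case: s' s0 {ps' ls' Cs rs} => //=; rewrite eqxx.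
have ZN : nth z (z :: s') (size s') = nth z (z :: s') 0.
  by rewrite -(last_nth z z s') ls'.
have [x [? Ax]] := legs_closed_characteristic s'0 ZN aC cC Cs rs.
by exists x; rewrite Ax leg_sum_nth.
Qed.

Lemma interior_box (K : set (pt4 R)) z0 : interior K z0 -> exists2 e : R, 0 < e &
  forall w, `|w.1.1 - z0.1.1| < e -> `|w.1.2 - z0.1.2| < e ->
            `|w.2.1 - z0.2.1| < e -> `|w.2.2 - z0.2.2| < e -> K w.
Proof.
move=> /nbhs_ballP[e /= e0 H]; exists e => // w a b c d; apply: H.
by split; split; rewrite /ball/= distrC.
Qed.

Lemma interior_dir (K : set (pt4 R)) z0 w : interior K z0 -> exists2 d : R, 0 < d &
  K ((z0.1.1 + d * w.1.1, z0.1.2 + d * w.1.2),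
     (z0.2.1 + d * w.2.1, z0.2.2 + d * w.2.2)).
Proof.
move=> /interior_box[e e0 H].
(* The summand [1] makes every coordinate of [w] strictly smaller than [m], also for [w = 0]. *)
pose m := `|w.1.1| + `|w.1.2| + `|w.2.1| + `|w.2.2| + 1.
have m0 : 0 < m by rewrite /m ltr_wpDl// !addr_ge0.
have small x : `|x| < m -> `|e / m * x| < e.
  move=> xm; rewrite normrM gtr0_norm ?divr_gt0// -mulrA -[ltRHS]mulr1.
  by rewrite ltr_pM2l// mulrC ltr_pdivrMr// mul1r.
exists (e / m); first exact: divr_gt0.
have := normr_ge0 w.1.1; have := normr_ge0 w.1.2.
have := normr_ge0 w.2.1; have := normr_ge0 w.2.2 => n1 n2 n3 n4.
by apply: H; rewrite /= addrAC subrr add0r; apply: small; rewrite /m; lra.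
Qed.

(** A small step [d * n] from the interior point [z0.1] stays in [Q], so [dot2 n] at [q] exceeds its
    value at [z0.1] by at least [d * dot2 n n]. *)
Lemma normal_pos_l Q T z0 q n : interior (Q `*` T) z0 -> normal_cone Q q n ->
  n <> 0 -> 0 < dot2 n (sub2 q z0.1).
Proof.
move=> i0 nq n0; have [d d0 [/= /nq + _]] := interior_dir (n, (0, 0)) i0.
have : 0 < n.1 ^+ 2 + n.2 ^+ 2.
  rewrite lt_neqAle addr_ge0 ?sqr_ge0// andbT eq_sym paddr_eq0 ?sqr_ge0//.
  rewrite !sqrf_eq0; apply/negP => /andP[/eqP a /eqP b]; apply: n0.
  by case: n a b {nq} => /= ? ? -> ->.
rewrite /dot2 /sub2/=; nra.
Qed.

Lemma normal_pos_r Q T z0 p n : interior (Q `*` T) z0 -> normal_cone T p n ->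
  n <> 0 -> 0 < dot2 n (sub2 p z0.2).
Proof.
move=> i0 nq n0; have [d d0 [/= _ /nq +]] := interior_dir ((0, 0), n) i0.
have : 0 < n.1 ^+ 2 + n.2 ^+ 2.
  rewrite lt_neqAle addr_ge0 ?sqr_ge0// andbT eq_sym paddr_eq0 ?sqr_ge0//.
  rewrite !sqrf_eq0; apply/negP => /andP[/eqP a /eqP b]; apply: n0.
  by case: n a b {nq} => /= ? ? -> ->.
rewrite /dot2 /sub2/=; nra.
Qed.

(** The momentum is fixed, so [v] is [(0, n / k)] with [n] the displacement; the factor [k],
    positive because [z0] is interior, normalises [ip4 v] to [1] at [p]. *)
Lemma char_leg_q Q T z0 q q' p : interior (Q `*` T) z0 ->
  normal_cone T p (sub2 q' q) ->
  sub4 (q, p) z0 = sub4 (q', p) z0 \/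
  char_leg (translate4 (Q `*` T) z0) (sub4 (q, p) z0) (sub4 (q', p) z0).
Proof.
move=> i0 np; have [E|/eqP n0] := eqVneq (sub2 q' q) 0.
  left; rewrite /sub4/=; case: E => /subr0_eq -> /subr0_eq ->//.
right; set n := sub2 q' q in np n0.
have := normal_pos_r i0 np n0; set k := dot2 _ _ => k0.
exists k, ((0, 0), (n.1 / k, n.2 / k)); split => //.
- rewrite /sub4 /scale4 /J4/= !oppr0 !mulr0 !subrr.
  rewrite !(mulrC k) !mulfVK ?gt_eqF// /n /sub2/=.
  by congr (_, _, _); ring.
- move=> _ [w [_ /np Tw] <-].
  rewrite /ip4/= !mul0r !add0r.
  rewrite (_ : _ + _ = dot2 n (sub2 w.2 z0.2) / k).
    rewrite ler_pdivrMr// mul1r /k.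
    by move: Tw; rewrite /dot2 /sub2/=; lra.
  by rewrite /dot2/=; ring.
- rewrite /ip4/= !mul0r !add0r (_ : _ + _ = dot2 n (sub2 p z0.2) / k).
    by rewrite -/k divff// gt_eqF.
  by rewrite /dot2 /sub2/=; ring.
- rewrite /ip4/= !mul0r !add0r (_ : _ + _ = dot2 n (sub2 p z0.2) / k).
    by rewrite -/k divff// gt_eqF.
  by rewrite /dot2 /sub2/=; ring.
Qed.

(** [J4] sends [(n, 0)] to [(0, - n)]: at a bounce the momentum moves against the outer normal of
    [Q], which is why the displacement enters as [sub2 p p']. *)
Lemma char_leg_p Q T z0 q p p' : interior (Q `*` T) z0 ->
  normal_cone Q q (sub2 p p') ->
  sub4 (q, p) z0 = sub4 (q, p') z0 \/
  char_leg (translate4 (Q `*` T) z0) (sub4 (q, p) z0) (sub4 (q, p') z0).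
Proof.
move=> i0 np; have [E|/eqP n0] := eqVneq (sub2 p p') 0.
  left; rewrite /sub4/=; case: E => /subr0_eq -> /subr0_eq ->//.
right; set n := sub2 p p' in np n0.
have := normal_pos_l i0 np n0; set k := dot2 _ _ => k0.
exists k, ((n.1 / k, n.2 / k), (0, 0)); split => //.
- rewrite /sub4 /scale4 /J4/= !mulr0 !subrr !mulrN.
  rewrite !(mulrC k) !mulfVK ?gt_eqF// /n /sub2/=.
  by congr (_, (_, _)); ring.
- move=> _ [w [/np Qw _] <-].
  rewrite /ip4/= !mul0r !addr0.
  rewrite (_ : _ + _ = dot2 n (sub2 w.1 z0.1) / k).
    rewrite ler_pdivrMr// mul1r /k.
    by move: Qw; rewrite /dot2 /sub2/=; lra.
  by rewrite /dot2/=; ring.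
- rewrite /ip4/= !mul0r !addr0 (_ : _ + _ = dot2 n (sub2 q z0.1) / k).
    by rewrite -/k divff// gt_eqF.
  by rewrite /dot2 /sub2/=; ring.
- rewrite /ip4/= !mul0r !addr0 (_ : _ + _ = dot2 n (sub2 q z0.1) / k).
    by rewrite -/k divff// gt_eqF.
  by rewrite /dot2 /sub2/=; ring.
Qed.

Lemma translate_absorbing (K : set (pt4 R)) z0 : interior K z0 -> absorbing4 (translate4 K z0).
Proof.
move=> i0 w; have [d d0 Kd] := interior_dir w i0.
exists d^-1, (scale4 d w); split; first by rewrite invr_ge0 ltW.
  eexists; first exact: Kd.
  by rewrite /sub4 /scale4/=; congr (_, _, (_, _)); ring.
rewrite /scale4/= !mulKf ?gt_eqF//.
by case: w {Kd} => -[? ?] [? ?].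
Qed.

Lemma translate_prod_convex Q T z0 : convex2 Q -> convex2 T ->
  convex4 (translate4 (Q `*` T) z0).
Proof.
move=> cQ cT _ _ r [z [Qz Tz] <-] [w [Qw Tw] <-] r01.
exists (add2 (scale2 r w.1) (scale2 (1 - r) z.1),
        add2 (scale2 r w.2) (scale2 (1 - r) z.2)).
  by split; [exact: cQ|exact: cT].
by rewrite /sub4 /ladd4 /add2 /scale2/=; congr (_, _, (_, _)); ring.
Qed.

(* The phase-space curve alternates between a flight [q_i -> q_(i+1)] with
   momentum [p_i] and a bounce [p_i -> p_(i+1)] at [q_(i+1)]. *)
Lemma billiard_closed_characteristic Q T z0 q1 q2 q3 p1 p2 p3 :
  convex2 Q -> convex2 T -> interior (Q `*` T) z0 ->
  Q q1 -> Q q2 -> Q q3 -> T p1 -> T p2 -> T p3 ->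
  normal_cone T p1 (sub2 q2 q1) -> normal_cone T p2 (sub2 q3 q2) ->
  normal_cone T p3 (sub2 q1 q3) ->
  normal_cone Q q1 (sub2 p3 p1) -> normal_cone Q q2 (sub2 p1 p2) ->
  normal_cone Q q3 (sub2 p2 p3) ->
  let A := dot2 (sub2 q2 q1) p1 + dot2 (sub2 q3 q2) p2 + dot2 (sub2 q1 q3) p3 in
  0 < A ->
  exists x, closed_characteristic (translate4 (Q `*` T) z0) x /\ action x = A.
Proof.
move=> cQ cT i0 Q1 Q2 Q3 T1 T2 T3 n1 n2 n3 m1 m2 m3 A A0.
pose z q p := sub4 (q, p) z0.
pose s := [:: z q2 p1; z q2 p2; z q3 p2; z q3 p3; z q1 p3; z q1 p1].
(* The flights contribute [- A] to [leg_sum] and, by summation by parts, so do the bounces; the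
   shift by [z0] drops out because the loop closes. *)
have sA : - (1 / 2) * leg_sum (z q1 p1) s = A.
  by rewrite /A /= /ip4 /J4 /sub4 /dot2 /sub2/=; field.
have Cz q p : Q q -> T p -> translate4 (Q `*` T) z0 (z q p).
  by move=> Qq Tp; exists (q, p).
have [||||x [cx xA]] := @leg_path_closed_characteristic (translate4 (Q `*` T) z0)
  (z q1 p1) s (translate_absorbing i0) (translate_prod_convex (z0 := z0) cQ cT).
- exact: Cz.
- do 6 (split; first by split; [exact: Cz|
    by [exact: char_leg_q|exact: char_leg_p]]).
  by [].
- by [].
- by apply: contraTN A0 => /eqP s0; rewrite -sA s0 mulr0 ltxx.
- by exists x; rewrite -sA.
Qed.

End Billiard.

(** * Compactness and continuity *)

Section CompactLimit.
Variable R : realType.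

(** The sets of [e]-approximate solutions shrink with [e] and generate a proper filter; by
    continuity, a cluster point of it satisfies all constraints exactly. *)
Lemma compact_limit (X : topologicalType) (I : Type) (A : set X)
    (f : I -> X -> R) : compact A -> (forall i, continuous (f i)) ->
  (forall e, 0 < e -> exists2 x, A x & forall i, f i x <= e) ->
  exists2 x, A x & forall i, f i x <= 0.
Proof.
move=> cA cf H.
pose B e := A `&` [set x | forall i, f i x <= e].
pose F := filter_from [set e : R | 0 < e] B.
have FF : ProperFilter F.
  apply: filter_from_proper; last by move=> e /H[x Ax fx]; exists x.
  apply: filter_from_filter; first by exists 1; rewrite /=.
  move=> d e d0 e0; exists (Num.min d e); first by rewrite /= lt_min d0.
  by move=> x [Ax fx]; split; split => // i; have := fx i; rewrite le_min => /andP[].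
have [|x [Ax clx]] := cA F FF; first by exists 1; rewrite /=; [|move=> ? []].
exists x => // i; rewrite leNgt; apply/negP => fx0.
have fx2 : 0 < f i x / 2 by rewrite divr_gt0.
have FB : F (B (f i x / 2)) by exists (f i x / 2).
have nU : nbhs x [set y | f i x / 2 < f i y].
  by apply: (cvgr_gt (f i x)); [exact: cf|rewrite ltr_pdivrMr//; lra].
have [y [[_ /(_ i) h1] h2]] := clx _ _ FB nU.
by move: (lt_le_trans h2 h1); rewrite ltxx.
Qed.

Lemma fst_continuous_comp (X U V : topologicalType) (f : X -> U * V) :
  continuous f -> continuous (fun x => (f x).1).
Proof. by move=> cf x; apply: (cvg_comp _ _ (cf x)); exact: cvg_fst. Qed.
Lemma snd_continuous_comp (X U V : topologicalType) (f : X -> U * V) :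
  continuous f -> continuous (fun x => (f x).2).
Proof. by move=> cf x; apply: (cvg_comp _ _ (cf x)); exact: cvg_snd. Qed.
Lemma pair_continuous (X U V : topologicalType) (f : X -> U) (g : X -> V) :
  continuous f -> continuous g -> continuous (fun x => (f x, g x)).
Proof. by move=> cf cg x; apply: cvg_pair; [exact: cf|exact: cg]. Qed.
Lemma add_continuous_comp (X : topologicalType) (f g : X -> R) :
  continuous f -> continuous g -> continuous (fun x => f x + g x).
Proof. by move=> cf cg x; apply: cvgD; [exact: cf|exact: cg]. Qed.
Lemma opp_continuous_comp (X : topologicalType) (f : X -> R) :
  continuous f -> continuous (fun x => - f x).
Proof. by move=> cf x; apply: cvgN; exact: cf. Qed.
Lemma mul_continuous_comp (X : topologicalType) (f g : X -> R) :
  continuous f -> continuous g -> continuous (fun x => f x * g x).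
Proof. by move=> cf cg x; apply: cvgM; [exact: cf|exact: cg]. Qed.
Lemma norm_continuous_comp (X : topologicalType) (f : X -> R) :
  continuous f -> continuous (fun x => `|f x|).
Proof. by move=> cf x; apply: cvg_norm; exact: cf. Qed.
Lemma id_continuous (X : topologicalType) : continuous (fun x : X => x).
Proof. by move=> x; exact: cvg_id. Qed.
Lemma cst_continuous_fun (X Y : topologicalType) (y : Y) : continuous (fun x : X => y).
Proof. by move=> x; exact: cvg_cst. Qed.
End CompactLimit.

Ltac cont := lazymatch goal with
  | |- continuous (fun _ => ?y) => exact: cst_continuous_fun
  | |- continuous (fun x => x) => exact: id_continuous
  | |- continuous (fun x => (@?f x, @?g x)) =>
      refine (pair_continuous (f := f) (g := g) _ _); cont
  | |- continuous (fun x => @?f x + @?g x) =>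
      refine (add_continuous_comp (f := f) (g := g) _ _); cont
  | |- continuous (fun x => @?f x * @?g x) =>
      refine (mul_continuous_comp (f := f) (g := g) _ _); cont
  | |- continuous (fun x => - @?f x) =>
      refine (opp_continuous_comp (f := f) _); cont
  | |- continuous (fun x => `|@?f x|) =>
      refine (norm_continuous_comp (f := f) _); cont
  | |- continuous (fun x => (@?f x).1) =>
      refine (fst_continuous_comp (f := f) _); cont
  | |- continuous (fun x => (@?f x).2) =>
      refine (snd_continuous_comp (f := f) _); cont
  end.

(** * Largest inscribed copies *)

Section InscribedCopy.
Variable R : realType.
Implicit Types (T : set (pt2 R)) (p q n r : pt2 R).

Lemma convex_bodyP T : convex_body2 T -> [/\ compact T, closed T, convex2 T &
  interior T !=set0].
Proof.
move=> [cT [vT iT]]; split => //.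
exact: (compact_closed (@norm_hausdorff _ (R * R)%type)).
Qed.

Lemma interior_setX T1 T2 p q : interior T1 p -> interior T2 q ->
  interior (T1 `*` T2) (p, q).
Proof. by move=> i1 i2; exists (T1, T2). Qed.

Lemma normal_pos T b p n : interior T b -> normal_cone T p n -> n <> 0 ->
  0 < dot2 n (sub2 p b).
Proof.
move=> iT; apply: (@normal_pos_r _ [set: pt2 R] T ((0, 0), b)).
by apply: interior_setX => //; exact: filterT.
Qed.

Lemma compact_bounded_coord T : compact T -> T !=set0 -> exists2 B : R, 0 < B &
  forall p, T p -> `|p.1| <= B /\ `|p.2| <= B.
Proof.
move=> cT T0.
have cf : continuous (fun p : R * R => `|p.1| + `|p.2|) by cont.
have [c cT' H] := compact_EVT_max T0 cT (continuous_subspaceT (A := T) cf).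
exists (`|c.1| + `|c.2| + 1).
  by rewrite ltr_wpDl// addr_ge0.
move=> p /mem_set/H.
have := normr_ge0 p.1; have := normr_ge0 p.2 => ? ? ?; split; lra.
Qed.

Lemma first_order (D E : R) : 0 <= D ->
  (forall t, 0 <= t <= 1 -> 0 <= t ^+ 2 * D - 2 * t * E) -> E <= 0.
Proof.
move=> D0 H; rewrite leNgt; apply/negP => E0.
have DE : 0 < D + E by lra.
(* This [t] lies in [[0, 1]] even when [D = 0] and satisfies [t * D <= E], so the quadratic would be
   negative there. *)
have := H (E / (D + E)).
have [t0 t1] : 0 < E / (D + E) /\ E / (D + E) <= 1.
  by split; [exact: divr_gt0|rewrite ler_pdivrMr//; lra].
have tD : E / (D + E) * D <= E.
  by rewrite mulrAC ler_pdivrMr//; nra.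
move: t0 t1 tD; set t := _ / _ => t0 t1 tD /(_ _).
have -> : 0 <= t <= 1 by rewrite t1 ltW.
move=> /(_ isT); nra.
Qed.

(** With [r1 = r2] the triangle degenerates to a chord, so chords and triangles are treated
    together. *)
Definition has_copy T r1 r2 s := exists p,
  [/\ T p, T (add2 p (scale2 s r1)) & T (add2 p (scale2 s r2))].

(** A linear functional of the differences [(x1 - x0, x2 - x0)] minus its value at [s (r1, r2)]. If
    it is nonpositive on triples of [T], a hyperplane separates these differences from the copy of
    size [s]. *)
Definition copy_gap (m : pt2 R * pt2 R) (r1 r2 : pt2 R) (s : R)
    (x : pt2 R * (pt2 R * pt2 R)) : R :=
  dot2 m.1 (sub2 x.2.1 x.1) + dot2 m.2 (sub2 x.2.2 x.1)
  - s * (dot2 m.1 r1 + dot2 m.2 r2).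

Definition l1norm4 (m : pt2 R * pt2 R) : R :=
  `|m.1.1| + `|m.1.2| + (`|m.2.1| + `|m.2.2|).

(** The vector [m] points from the nearest realisable pair of differences to [s (r1, r2)]; it is
    nonzero because there is no copy of size [s]. Normalising it confines the separating functionals
    to a compact set. *)
Lemma separate_copy T r1 r2 s : convex_body2 T -> ~ has_copy T r1 r2 s ->
  exists2 m, l1norm4 m = 1 & forall x, (T `*` (T `*` T)) x ->
    copy_gap m r1 r2 s x <= 0.
Proof.
move=> /convex_bodyP[cT _ vT [b iT]] ncopy.
have T0 : T !=set0 by exists b; exact: interior_subset.
pose TTT := T `*` (T `*` T).
have TTT0 : TTT !=set0 by case: T0 => c Tc; exists (c, (c, c)).
have cTTT : compact TTT by apply: compact_setX => //; exact: compact_setX.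
pose phi (x : (R * R) * ((R * R) * (R * R))) : R :=
  (x.2.1.1 - x.1.1 - s * r1.1) * (x.2.1.1 - x.1.1 - s * r1.1) +
  (x.2.1.2 - x.1.2 - s * r1.2) * (x.2.1.2 - x.1.2 - s * r1.2) +
  ((x.2.2.1 - x.1.1 - s * r2.1) * (x.2.2.1 - x.1.1 - s * r2.1) +
  (x.2.2.2 - x.1.2 - s * r2.2) * (x.2.2.2 - x.1.2 - s * r2.2)).
have cphi : continuous phi by rewrite /phi; cont.
have [y /set_mem Ty Hy] :=
  compact_EVT_min TTT0 cTTT (continuous_subspaceT (A := TTT) cphi).
pose m : pt2 R * pt2 R :=
  ((s * r1.1 - (y.2.1.1 - y.1.1), s * r1.2 - (y.2.1.2 - y.1.2)),
   (s * r2.1 - (y.2.2.1 - y.1.1), s * r2.2 - (y.2.2.2 - y.1.2))).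
have m0 : 0 < l1norm4 m.
  rewrite lt_neqAle; apply/andP; split; last by rewrite !addr_ge0.
  apply/eqP => /esym/eqP; rewrite /l1norm4 !paddr_eq0 ?addr_ge0// !normr_eq0.
  move=> /andP[/andP[/eqP e1 /eqP e2] /andP[/eqP e3 /eqP e4]].
  case: Ty => Ty1 [Ty2 Ty3].
  apply: ncopy; exists y.1; rewrite /add2 /scale2; split => //.
    rewrite (_ : (_, _) = y.2.1)//; rewrite [RHS]surjective_pairing.
    by move: e1 e2; rewrite /m/= => e1 e2; congr (_, _); lra.
  rewrite (_ : (_, _) = y.2.2)//; rewrite [RHS]surjective_pairing.
  by move: e3 e4; rewrite /m/= => e3 e4; congr (_, _); lra.
exists (scale2 (l1norm4 m)^-1 m.1, scale2 (l1norm4 m)^-1 m.2).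
  rewrite /l1norm4/= !normrM -!mulrDr (gtr0_norm (x := (l1norm4 m)^-1)) ?invr_gt0//.
  by rewrite mulVf// gt_eqF.
move=> x Tx; rewrite (_ : copy_gap _ _ _ _ _ = (l1norm4 m)^-1 * copy_gap m r1 r2 s x).
  rewrite pmulr_rle0 ?invr_gt0//.
  have mm : 0 <= m.1.1 ^+ 2 + m.1.2 ^+ 2 + m.2.1 ^+ 2 + m.2.2 ^+ 2.
    by rewrite !addr_ge0 ?sqr_ge0.
  (* Moving from the minimiser [y] towards [x] changes [phi] by [t^2 |d|^2 - 2 t E], where [E] is
     the gap plus [|m|^2]; minimality forces [E <= 0]. *)
  apply: (@le_trans _ _ (copy_gap m r1 r2 s x +
    (m.1.1 ^+ 2 + m.1.2 ^+ 2 + m.2.1 ^+ 2 + m.2.2 ^+ 2))); first by rewrite lerDl.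
  pose d : pt2 R * pt2 R := ((x.2.1.1 - x.1.1 - (y.2.1.1 - y.1.1),
             x.2.1.2 - x.1.2 - (y.2.1.2 - y.1.2)),
            (x.2.2.1 - x.1.1 - (y.2.2.1 - y.1.1),
             x.2.2.2 - x.1.2 - (y.2.2.2 - y.1.2))).
  apply: (@first_order (d.1.1 ^+ 2 + d.1.2 ^+ 2 + d.2.1 ^+ 2 + d.2.2 ^+ 2)).
    by rewrite !addr_ge0 ?sqr_ge0.
  move=> t t01.
  pose c (u v : pt2 R) := add2 (scale2 t u) (scale2 (1 - t) v).
  have : TTT (c x.1 y.1, (c x.2.1 y.2.1, c x.2.2 y.2.2)).
    case: Tx Ty => [? [? ?]] [? [? ?]].
    by split; [exact: vT|split; exact: vT].
  move=> /mem_set/Hy; rewrite /phi /c /copy_gap /dot2 /sub2 /d /m /add2 /scale2/=.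
  rewrite -subr_ge0 => h; apply: le_trans h _; rewrite le_eqVlt; apply/orP; left.
  by apply/eqP; ring.
rewrite /copy_gap /dot2 /scale2 /sub2/=; ring.
Qed.

Lemma max_copy T r1 r2 : convex_body2 T -> r1 <> 0 ->
  exists s, [/\ 0 < s, has_copy T r1 r2 s & forall t, s < t -> ~ has_copy T r1 r2 t].
Proof.
move=> bT r10; have [cT clT vT [b iT]] := convex_bodyP bT.
have T0 : T !=set0 by exists b; exact: interior_subset.
have [B B0 HB] := compact_bounded_coord cT T0.
have [d d0 [/= Td1 Td2]] := interior_dir (r1, r2) (interior_setX iT iT).
(* Two points of [T] differ by at most [2 * B] in each coordinate, which bounds the size of a copy;
   the term [d] makes room for the small copy just found. *)
pose M := d + 2 * B / (`|r1.1| + `|r1.2|) + 2 * B / (`|r1.1| + `|r1.2|).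
have r1n : 0 < `|r1.1| + `|r1.2|.
  rewrite lt_neqAle addr_ge0// andbT eq_sym paddr_eq0// !normr_eq0.
  apply/negP => /andP[/eqP a /eqP c]; apply: r10.
  by case: r1 a c {Td1 M} => /= ? ? -> ->.
have M0 : 0 <= 2 * B / (`|r1.1| + `|r1.2|) by rewrite divr_ge0 ?mulr_ge0// ltW.
have bnd t : has_copy T r1 r2 t -> t <= M.
  move=> [p [Tp Tp1 _]]; have [t0|t0] := leP t 0.
    by rewrite (le_trans t0)// /M !addr_ge0// ltW.
  rewrite /M -addrA -mulrDl.
  apply: (@le_trans _ _ ((2 * B + 2 * B) / (`|r1.1| + `|r1.2|))); last first.
    by rewrite lerDr ltW.
  rewrite ler_pdivlMr// mulrDr -{1 2}(gtr0_norm t0) -!normrM.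
  have [h1 h2] := HB _ Tp; have [/= h3 h4] := HB _ Tp1.
  have K (u v : R) : `|u| <= B -> `|u + v| <= B -> `|v| <= 2 * B.
    move=> hu huv; rewrite (_ : v = (u + v) - u); last by ring.
    by apply: le_trans (ler_normB _ _) _; lra.
  by apply: lerD; [apply: (K p.1)|apply: (K p.2)].
(* Pairs of a size and a base point whose copy lies in [T]; the size is maximised over this compact
   set. *)
pose A := [set z : R * (R * R) | `[0, M]%classic z.1 /\ T z.2] `&`
  ((fun z : R * (R * R) => add2 z.2 (scale2 z.1 r1)) @^-1` T `&`
   (fun z : R * (R * R) => add2 z.2 (scale2 z.1 r2)) @^-1` T).
have cA : compact A.
  apply: (@subclosed_compact _ _ (`[0, M]%classic `*` T)).
  - apply: closedI; last apply: closedI.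
    + apply: compact_closed; first exact: (@norm_hausdorff _ (R * (R * R))%type).
      exact: compact_setX (@segment_compact _ _ _) cT.
    + apply: preimage_closed => // z _; move: z; rewrite /add2 /scale2; cont.
    + apply: preimage_closed => // z _; move: z; rewrite /add2 /scale2; cont.
  - exact: compact_setX (@segment_compact _ _ _) cT.
  - by move=> z [].
have Ab : A (d, b).
  split; first split.
  - by rewrite /= in_itv/= ltW//= /M -addrA lerDl addr_ge0.
  - exact: interior_subset.
  - by split.
have cf : continuous (fun z : R * (R * R) => z.1) by cont.
have [[s p] /set_mem Asp Hs] := compact_EVT_max (ex_intro _ _ Ab) cA
  (continuous_subspaceT (A := A) cf).
exists s; split.
- by apply: lt_le_trans d0 _; exact: (Hs _ (mem_set Ab)).
- by case: Asp => [[_ Tp] [T1 T2]]; exists p.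
- move=> t st [q [Tq T1 T2]].
  have t0 : 0 < t.
    by apply: lt_trans st; apply: lt_le_trans d0 _; exact: (Hs _ (mem_set Ab)).
  have : A (t, q).
    split; last by split.
    split => //=; rewrite in_itv/= ltW//=; apply: bnd; by exists q.
  by move=> /mem_set/Hs /=; rewrite leNgt st.
Qed.

(** Sizes slightly above the maximal one are separated from [T]; in the limit a functional separates
    at the maximal size itself. The maximal copy attains equality, so the components of the
    functional and minus their sum are normals at its vertices. The final scaling makes the dual
    value of a copy equal to its size. *)
Lemma inscribed_copy T r1 r2 : convex_body2 T -> r1 <> 0 ->
  exists s p n1 n2,
    [/\ 0 < s, T p, T (add2 p (scale2 s r1)) & T (add2 p (scale2 s r2))] /\
    [/\ normal_cone T (add2 p (scale2 s r1)) n1,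
        normal_cone T (add2 p (scale2 s r2)) n2,
        normal_cone T p (scale2 (-1) (add2 n1 n2)) &
        dot2 n1 r1 + dot2 n2 r2 = 1].
Proof.
move=> bT r10; have [cT clT vT [b iT]] := convex_bodyP bT.
have [s [s0 [p [Tp Tp1 Tp2]] smax]] := max_copy r2 bT r10.
pose I := {x | (T `*` (T `*` T)) x}.
pose S := [set m : (R * R) * (R * R) | l1norm4 m = 1].
have cS : compact S.
  pose B := `[(-1 : R), 1]%classic.
  have cB : compact (B `*` B `*` (B `*` B)).
    by do !apply: compact_setX; exact: segment_compact.
  apply: subclosed_compact cB _.
    apply: (@preimage_closed _ _ l1norm4 [set x | x = 1]); last exact: closed_eq.
    by move=> z _; move: z; rewrite /l1norm4; cont.
  move=> z; rewrite /S/= /l1norm4 => z1.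
  have h1 := normr_ge0 z.1.1; have h2 := normr_ge0 z.1.2.
  have h3 := normr_ge0 z.2.1; have h4 := normr_ge0 z.2.2.
  by split; split; rewrite /B/= in_itv/= -ler_norml; lra.
pose g (x : I) m := copy_gap m r1 r2 s (sval x).
(* Bounds [dot2 m.1 r1 + dot2 m.2 r2] for every normalised [m], so raising the size by [e / c] costs
   at most [e]. *)
pose c := 1 + `|r1.1| + `|r1.2| + (`|r2.1| + `|r2.2|).
have c0 : 0 < c.
  by rewrite /c -!addrA ltr_wpDr// !addr_ge0.
have [||m Sm Hm] := compact_limit (f := g) cS.
- by move=> x; rewrite /g /copy_gap /dot2; cont.
- move=> e e0.
  have [|m m1 Hm] := @separate_copy T r1 r2 (s + e / c) bT.
    by apply: smax; rewrite ltrDl divr_gt0.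
  exists m => // -[x Tx]; rewrite /g/=.
  have := Hm _ Tx; rewrite /copy_gap; set u := dot2 m.1 r1 + _.
  suff : e / c * u <= e by nra.
  rewrite mulrAC ler_pdivrMr// ler_wpM2l//; first exact: ltW.
  rewrite /u /dot2 /c; move: m1; rewrite /l1norm4 => m1.
  have ub (v w : R) : `|v| <= 1 -> v * w <= `|w|.
    move=> v1; apply: le_trans (ler_norm _) _; rewrite normrM.
    by rewrite ler_piMl.
  have h1 := normr_ge0 m.1.1; have h2 := normr_ge0 m.1.2.
  have h3 := normr_ge0 m.2.1; have h4 := normr_ge0 m.2.2.
  have := ub m.1.1 r1.1 _; have := ub m.1.2 r1.2 _.
  have := ub m.2.1 r2.1 _; have := ub m.2.2 r2.2 _; lra.
have {}Hm x0 x1 x2 : T x0 -> T x1 -> T x2 ->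
    dot2 m.1 (sub2 x1 x0) + dot2 m.2 (sub2 x2 x0) <=
    s * (dot2 m.1 r1 + dot2 m.2 r2).
  move=> t0 t1 t2.
  have Tx : (T `*` (T `*` T)) (x0, (x1, x2)) by [].
  by have := Hm (exist _ _ Tx); rewrite /g /copy_gap/= subr_le0.
set p1 := add2 p _ in Tp1; set p2 := add2 p _ in Tp2.
have n1 : normal_cone T p1 m.1.
  by move=> x Tx; have := Hm _ _ _ Tp Tx Tp2; rewrite /dot2 /p1 /p2 /add2 /scale2 /sub2/=; lra.
have n2 : normal_cone T p2 m.2.
  by move=> x Tx; have := Hm _ _ _ Tp Tp1 Tx; rewrite /dot2 /p1 /p2 /add2 /scale2 /sub2/=; lra.
have n0 : normal_cone T p (scale2 (-1) (add2 m.1 m.2)).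
  by move=> x Tx; have := Hm _ _ _ Tx Tp1 Tp2; rewrite /dot2 /p1 /p2 /add2 /scale2 /sub2/=; lra.
(* [s * k] is the sum of the heights of the three supporting lines over the interior point [b]; none
   is negative, and one is positive as [m] is nonzero. *)
pose k := dot2 m.1 r1 + dot2 m.2 r2.
have k0 : 0 < k.
  have nn q n : normal_cone T q n -> 0 <= dot2 n (sub2 q b).
    move=> /(_ b (interior_subset iT)); rewrite /dot2 /sub2/=; lra.
  suff : 0 < s * k by rewrite pmulr_rgt0.
  have -> : s * k = dot2 m.1 (sub2 p1 b) + dot2 m.2 (sub2 p2 b)
      + dot2 (scale2 (-1) (add2 m.1 m.2)) (sub2 p b).
    by rewrite /k /dot2 /p1 /p2 /add2 /scale2 /sub2/=; ring.
  have h0 := nn _ _ n0.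
  have [E1|/eqP m1] := eqVneq m.1 0; last first.
    by have := normal_pos iT n1 m1; have := nn _ _ n2; lra.
  have [E2|/eqP m2] := eqVneq m.2 0; last first.
    by have := normal_pos iT n2 m2; have := nn _ _ n1; lra.
  move: Sm; rewrite /S/= /l1norm4 E1 E2/= normr0 !addr0 => /eqP.
  by rewrite eq_sym oner_eq0.
have kV : 0 <= k^-1 by rewrite invr_ge0 ltW.
exists s, p, (scale2 k^-1 m.1), (scale2 k^-1 m.2); split; first by split.
have sc q n : normal_cone T q n -> normal_cone T q (scale2 k^-1 n).
  move=> nq x /nq h; have := ler_wpM2l kV h.
  by rewrite /dot2 /scale2/=; lra.
split; [exact: sc|exact: sc| |].
- have := sc _ _ n0; rewrite (_ : scale2 k^-1 _ = scale2 (-1)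
    (add2 (scale2 k^-1 m.1) (scale2 k^-1 m.2)))//.
  by rewrite /scale2 /add2/=; congr (_, _); ring.
- rewrite (_ : _ + _ = k^-1 * k); first by rewrite mulVf// gt_eqF.
  by rewrite /k /dot2 /scale2/=; ring.
Qed.

End InscribedCopy.

(** * Areas under affine maps *)

Section AffineArea.
Variable R : realType.
Notation mu := (@lebesgue_measure R).
Notation M := (measurableTypeR R).
Implicit Types (a b c d k s t : R).

Definition affine1 a b : R -> measurableTypeR R := fun x => a * x + b.

Lemma measurable_affine1 a b : measurable_fun [set: measurableTypeR R] (affine1 a b).
Proof.
apply: continuous_measurable_fun => x; apply: cvgD; last exact: cvg_cst.
by apply: cvgM; [exact: cvg_cst|exact: cvg_id].
Qed.

Definition affine1_measure a b :=
  measure_function_pushforward__canonical__measure_function_Measure mu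
    (measurable_affine1 a b).

(** By uniqueness of Lebesgue measure it suffices to compare the two measures on half-open
    intervals. *)
Lemma lebesgue_measure_affine a b (A : set R) : a != 0 -> measurable A ->
  (`|a|%:E * affine1_measure a b A = mu A)%E.
Proof.
move=> a0 mA.
have a0' : 0 <= `|a| by [].
pose k := NngNum a0'.
have e : forall X : set R, ocitv X -> mu X = mscale k (affine1_measure a b) X.
  move=> _ [[u v]] _ <-; rewrite /mscale/= /pushforward.
  have [agt0|alt0|] := ltgtP 0 a; last by move=> /esym/eqP; rewrite (negbTE a0).
    rewrite (_ : _ @^-1` _ = `](u - b) / a, (v - b) / a]%classic); last first.
      apply/seteqP; split => x /=; rewrite !in_itv/= /affine1 ltr_pdivrMr// ler_pdivlMr//;
        by move=> /andP[? ?]; apply/andP; split; lra.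
    rewrite !lebesgue_measure_itv/= !lte_fin ltr_pM2r ?invr_gt0// ltrD2r.
    case: ifP => _; last by rewrite mule0.
    rewrite gtr0_norm// -EFinM -EFinB; congr (_%:E).
    by field; rewrite gt_eqF.
  (* A negative slope reverses the interval, so the closed end moves to the left. *)
  rewrite (_ : _ @^-1` _ = `[(v - b) / a, (u - b) / a[%classic); last first.
    apply/seteqP; split => x /=; rewrite !in_itv/= /affine1 ltr_ndivlMr// ler_ndivrMr//;
      by move=> /andP[? ?]; apply/andP; split; lra.
  rewrite !lebesgue_measure_itv/= !lte_fin ltr_nM2r ?invr_lt0// ltrD2r.
  case: ifP => _; last by rewrite mule0.
  rewrite ltr0_norm// -EFinM -EFinB; congr (_%:E).
  by field; rewrite lt_eqF.
by rewrite (lebesgue_measure_unique e mA).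
Qed.

Lemma integral_affine a b (g : M -> \bar R) : a != 0 ->
  measurable_fun [set: M] g -> (forall x, (0 <= g x)%E) ->
  (`|a|%:E * \int[mu]_x g (a * x + b)%R = \int[mu]_x g x)%E.
Proof.
move=> a0 mg g0.
have a0' : 0 <= `|a| by [].
rewrite [RHS](eq_measure_integral (mscale (NngNum a0') (affine1_measure a b))).
  rewrite ge0_integral_mscale//; congr (_ * _)%E.
  rewrite ge0_integral_pushforward//; last exact: measurable_affine1.
by move=> A mA _; apply/esym; exact: lebesgue_measure_affine.
Qed.

(* [f] multiplies areas by [k^-1]. *)
Definition scales_area (f : pt2 R -> pt2 R) (k : R) :=
  measurable_fun [set: M * M] (f : M * M -> M * M) /\
  forall S, measurable (S : set (M * M)) -> (k%:E * area (f @^-1` S) = area S)%E.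

Lemma scales_area_comp f g k l : scales_area f k -> scales_area g l ->
  scales_area (f \o g) (k * l).
Proof.
move=> [mf fk] [mg gl]; split; first exact: measurableT_comp mf mg.
move=> S mS; rewrite comp_preimage EFinM -muleA gl ?fk//.
by rewrite -[X in measurable X]setTI; exact: mf.
Qed.

Lemma scales_area_swap : scales_area (fun p => (p.2, p.1)) 1.
Proof.
have msw : measurable_fun [set: M * M] (fun p : M * M => (p.2, p.1)).
  by apply: measurable_fun_pair; [exact: measurable_snd|exact: measurable_fst].
split => // S mS; rewrite mul1e.
have mS' : measurable ((fun p : M * M => (p.2, p.1)) @^-1` S).
  by rewrite -[X in measurable X]setTI; exact: msw.
rewrite /area; apply/esym.
pose m' := measure_function_pushforward__canonical__measure_function_Measure
  (mu \x mu)%E msw.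
have e (A B : set M) : measurable A -> measurable B -> m' (A `*` B) = (mu A * mu B)%E.
  move=> mA mB.
  rewrite /m'/= /pushforward.
  rewrite (_ : _ @^-1` _ = B `*` A); last by apply/seteqP; split => -[x y] [].
  by rewrite product_measure1E// muleC.
exact: (@product_measure_unique _ _ _ _ R mu mu m' e S mS).
Qed.

Lemma measurable_affine2 a b c : measurable_fun [set: M * M]
  (fun p : M * M => a * p.1 + b * p.2 + c).
Proof.
apply: measurable_funD; last exact: measurable_cst.
by apply: measurable_funD; apply: measurable_funM;
  [exact: measurable_cst|exact: measurable_fst|
   exact: measurable_cst|exact: measurable_snd].
Qed.

Lemma measurable_fun_affine2 a b s c d t : measurable_fun [set: M * M]
  (fun p : M * M => (a * p.1 + b * p.2 + s, c * p.1 + d * p.2 + t)).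
Proof. by apply: measurable_fun_pair; exact: measurable_affine2. Qed.

(** The vertical section of the preimage over [x] is an affine preimage of the section of [S] over
    [a * x + s], so the one-dimensional formula applies once in each variable. *)
Lemma scales_area_lower a c d s t : a != 0 -> d != 0 ->
  scales_area (fun p => (a * p.1 + 0 * p.2 + s, c * p.1 + d * p.2 + t)) (`|a * d|).
Proof.
move=> a0 d0; have mf := measurable_fun_affine2 a 0 s c d t.
split => // S mS; set f := (fun p : M * M => _) in mf *.
have mfS : measurable (f @^-1` S).
  by rewrite -[X in measurable X]setTI; exact: mf.
rewrite /area /product_measure1/= normrM EFinM -muleA.
rewrite -ge0_integralZl//; [|exact: measurable_fun_xsection].
rewrite (eq_integral (fun x : M => (mu \o xsection S) (a * x + s))); last first.
  move=> x _; rewrite /= -[RHS](lebesgue_measure_affine (c * x + t) d0); last first.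
    exact: measurable_xsection.
  rewrite /affine1_measure/= /pushforward; congr (_ * mu _)%E.
  have e y : c * x + d * y + t = affine1 d (c * x + t) y by rewrite /affine1; ring.
  by apply/seteqP; split => y; rewrite /xsection/= !inE /f/= e mul0r addr0.
apply: (@integral_affine a s (mu \o xsection S) a0) => //.
exact: measurable_fun_xsection.
Qed.

(** For [a != 0] the matrix is a lower triangular one times an upper shear, and the shear is a lower
    one conjugated by the swap; for [a = 0] the rows are exchanged first. *)
Lemma scales_area_affine a b s c d t : a * d - b * c != 0 ->
  scales_area (fun p => (a * p.1 + b * p.2 + s, c * p.1 + d * p.2 + t))
    (`|a * d - b * c|).
Proof.
have main a' b' s' c' d' t' : a' != 0 -> a' * d' - b' * c' != 0 ->
    scales_area (fun p => (a' * p.1 + b' * p.2 + s', c' * p.1 + d' * p.2 + t'))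
      (`|a' * d' - b' * c'|).
  move=> a0 det0.
  have dd : d' - c' * (b' / a') != 0.
    apply: contra_neq det0 => E.
    have -> : a' * d' - b' * c' = a' * (d' - c' * (b' / a')) by field.
    by rewrite E mulr0.
  have L := scales_area_lower c' s' t' a0 dd.
  have U := scales_area_lower (b' / a') 0 0 (oner_neq0 R) (oner_neq0 R).
  have := scales_area_comp L (scales_area_comp scales_area_swap
    (scales_area_comp U scales_area_swap)).
  rewrite (_ : `|_| * _ = `|a' * d' - b' * c'|); last first.
    by rewrite !mul1r normr1 !mulr1; congr `|_|; field.
  congr (scales_area _ _); apply/funext => p /=; congr (_, _); by field.
move=> det0; have [a0|] := eqVneq a 0; last by move=> a0; exact: main.
have c0 : c != 0.
  by apply: contra_neq det0 => ->; rewrite a0; ring.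
have := scales_area_comp scales_area_swap (main c d t a b s c0 _).
rewrite mul1r (_ : c * b - d * a = - (a * d - b * c)); last by ring.
by rewrite normrN oppr_eq0 det0; exact.
Qed.

End AffineArea.

(** * Volume of a product *)

Section VolProduct.
Variable R : realType.
Notation M := (measurableTypeR R).
Notation mu := (@lebesgue_measure R).

(* [area] is built on the type [measurableTypeR R] while [vol4] integrates
   over [R * R]: same measurable sets, but distinct structures. *)
Definition area_default : set (R * R)%type -> \bar R := @area R.

Let area_default0 : area_default set0 = 0%E.
Proof. exact: (@measure0 _ (M * M)%type R (product_measure1 mu mu)). Qed.
Let area_default_ge0 A : (0 <= area_default A)%E.
Proof. exact: (@measure_ge0 _ (M * M)%type R (product_measure1 mu mu)). Qed.
Let area_default_sigma : semi_sigma_additive area_default.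
Proof.
move=> F mF tF mUF.
exact: (@measure_semi_sigma_additive _ (M * M)%type R (product_measure1 mu mu) F mF tF mUF).
Qed.

HB.instance Definition _ := isMeasure.Build _ (R * R)%type R area_default
  area_default0 area_default_ge0 area_default_sigma.

Lemma vol4_setX_ge (Q T : set (pt2 R)) (r s : R) :
  measurable (Q : set (R * R)) -> measurable (T : set (R * R)) ->
  0 <= s -> (r%:E <= area Q)%E -> (s%:E <= area T)%E ->
  ((s * r)%:E <= vol4 (Q `*` T))%E.
Proof.
move=> mQ mT s0 rQ sT.
apply: (@le_trans _ _ (\int[area_default]_(x in Q) (cst s%:E x))%E).
  rewrite integral_cst// EFinM; apply: lee_wpmul2l; first by rewrite lee_fin.
  exact: rQ.
rewrite integral_mkcond.
have E x : (@area R \o xsection (Q `*` T)) x = (area T * (\1_Q x)%:E)%E.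
  rewrite /=; have [xQ|xQ] := boolP (x \in Q).
    by rewrite in_xsectionX// indicE xQ mule1.
  by rewrite notin_xsectionX// indicE (negbTE xQ) mule0; exact: area_default0.
apply: ge0_le_integral => //.
- move=> x _; rewrite patchE; case: ifP => // _; by rewrite lee_fin.
- apply/(measurable_restrictT _ mQ); exact: measurable_cst.
- rewrite (_ : _ \o _ = (fun x => area T * (\1_Q x)%:E)%E); last exact/funext.
  apply: emeasurable_funM; first exact: measurable_cst.
  exact/measurable_EFinP/measurable_indic.
- move=> x _; rewrite E patchE indicE; case: ifP => _; last by rewrite mule0.
  by rewrite mule1.
Qed.
End VolProduct.

(** * Areas of convex sets by slabs *)

Section ClosedMeasurable.
Variable R : realType.

(** Measurability refers to the product sigma-algebra; an open set is the countable union of the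
    rational boxes inside it. *)
Lemma open_measurable2 (O : set (R * R)) : open O -> measurable O.
Proof.
move=> oO.
pose box (q : rat * rat * rat) : set (R * R) :=
  `](ratr q.1.1 - ratr q.2), (ratr q.1.1 + ratr q.2)[%classic `*`
  `](ratr q.1.2 - ratr q.2), (ratr q.1.2 + ratr q.2)[%classic.
pose F q := if pselect (box q `<=` O) then box q else set0.
rewrite (_ : O = \bigcup_q F q).
  apply: countable_bigcupT_measurable => // q; rewrite /F.
  by case: pselect => [h|h] /=; [apply: measurableX; exact: measurable_itv|exact: measurable0].
apply/seteqP; split => [p Op|p [q _]]; last by rewrite /F; case: pselect => [h|h] //= /h.
have /nbhs_ballP[e /= e0 pe] : nbhs p O by exact: open_nbhs_nbhs.
have e2 : 0 < e / 2 by rewrite divr_gt0.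
have [r] := rat_in_itvoo e2.
rewrite in_itv/= => /andP[r0 re].
have r0' : p.1 - ratr r < p.1 by lra.
have r0'' : p.2 - ratr r < p.2 by lra.
have [a] := rat_in_itvoo r0'; rewrite in_itv/= => /andP[a1 a2].
have [b] := rat_in_itvoo r0''; rewrite in_itv/= => /andP[b1 b2].
exists ((a, b), r) => //; rewrite /F; case: pselect => [h|[]] /=.
  by split; rewrite /= in_itv/=; apply/andP; split; lra.
move=> x; rewrite /box/setX/= !in_itv/= => -[/andP[x1 x2] /andP[x3 x4]].
by apply: pe; split; rewrite /ball/= ltr_norml; apply/andP; split; lra.
Qed.

Lemma closed_measurable2 (C : set (R * R)) : closed C -> measurable C.
Proof.
move=> cC; rewrite -[C]setCK; apply: measurableC; apply: open_measurable2.
exact: closed_openC.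
Qed.

End ClosedMeasurable.

(** * Area from vertical chords *)

Section StripArea.
Variable R : realType.
Notation M := (measurableTypeR R).
Notation mu := (@lebesgue_measure R).
Variable S : set (pt2 R).
Hypothesis mS : measurable (S : set (M * M)).
Hypothesis cS : convex2 S.

Definition chord (x l : R) := exists2 u, S (x, u) & S (x, u + l).

Lemma chord_conv x y r l l' : 0 <= r <= 1 -> chord x l -> chord y l' ->
  chord (r * x + (1 - r) * y) (r * l + (1 - r) * l').
Proof.
move=> r01 [u u1 u2] [v v1 v2]; exists (r * u + (1 - r) * v).
  exact: (cS u1 v1 r01).
rewrite (_ : _ + _ + _ = r * (u + l) + (1 - r) * (v + l')); last by ring.
exact: (cS u2 v2 r01).
Qed.

Lemma chord_measure x l : 0 <= l -> chord x l -> (l%:E <= mu (xsection S x))%E.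
Proof.
move=> l0 [u u1 u2].
have -> : l%:E = mu `[u, u + l]%classic.
  rewrite lebesgue_measure_itv/= lte_fin; case: ltP => h.
    by rewrite -EFinD; congr (_%:E); ring.
  by congr (_%:E); lra.
apply: le_measure; rewrite ?inE//.
  exact: measurable_xsection.
move=> y /=; rewrite in_itv/= /xsection/= inE => /andP[h1 h2].
move: l0; rewrite le_eqVlt => /predU1P[l0|l0].
  by rewrite (_ : y = u)//; lra.
have := cS u1 u2; move=> /(_ ((u + l - y) / l)) H.
have <- : add2 (scale2 ((u + l - y) / l) (x, u))
    (scale2 (1 - (u + l - y) / l) (x, u + l)) = (x, y).
  by rewrite /add2 /scale2/=; congr (_, _); field; rewrite gt_eqF.
apply: H; apply/andP; split.
  by rewrite divr_ge0//; lra.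
by rewrite ler_pdivrMr//; lra.
Qed.

Definition slab (a b : R) := (\int[mu]_(x in `]a, b]) mu (xsection S x))%E.

(** Chord length is concave by [chord_conv], so it dominates the linear interpolation [f] of its two
    known values, whose integral is that of a trapezoid. *)
Lemma slab_ge a b l l' : a <= b -> 0 <= l -> 0 <= l' -> chord a l -> chord b l' ->
  (((b - a) * (l + l') / 2)%:E <= slab a b)%E.
Proof.
rewrite le_eqVlt => /predU1P[-> *|ab l0 l0' ca cb].
  by rewrite subrr !mul0r; apply: integral_ge0.
pose f x : R := l * ((b - x) / (b - a)) + l' * ((x - a) / (b - a)).
have ba : 0 < b - a by lra.
pose F x : R := - (l / (b - a) / 2) * (b - x) ^+ 2 + l' / (b - a) / 2 * (x - a) ^+ 2.
have cf : continuous f by rewrite /f; cont.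
have dF (x : R) : is_derive x (1 : R) F (f x).
  rewrite /F; apply: is_derive_eq.
  by rewrite /f /GRing.scale/=; field; rewrite gt_eqF.
have cF : continuous F.
  by move=> x; apply: differentiable_continuous; apply/derivable1_diffP; have [] := dF x.
have IF : (\int[mu]_(x in `[a, b]) (f x)%:E = ((b - a) * (l + l') / 2)%:E)%E.
  rewrite (@continuous_FTC2 R f F a b ab).
  - rewrite -EFinB /F; congr (_%:E); field; by rewrite gt_eqF.
  - exact: continuous_subspaceT.
  - split.
    + by move=> x _; have [] := dF x.
    + by apply: cvg_at_right_filter; exact: cF.
    + by apply: cvg_at_left_filter; exact: cF.
  - by move=> x _; rewrite derive1E; have [_ ->] := dF x.
have mf : measurable_fun [set: R] f by exact: continuous_measurable_fun.
rewrite -IF -integral_itv_obnd_cbnd; last first.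
  by apply/measurable_EFinP; exact: measurable_funTS mf.
rewrite /slab; apply: ge0_le_integral => //=.
- move=> x; rewrite in_itv/= => /andP[ax xb]; rewrite lee_fin /f.
  by rewrite addr_ge0// mulr_ge0// divr_ge0//; lra.
- by apply/measurable_EFinP; exact: measurable_funTS mf.
- by apply: measurable_funTS; exact: measurable_fun_xsection.
- move=> x; rewrite in_itv/= => /andP[ax xb]; apply: chord_measure.
    by rewrite /f addr_ge0// mulr_ge0// divr_ge0//; lra.
  have := @chord_conv a b ((b - x) / (b - a)) l l' _ ca cb.
  rewrite (_ : _ * a + _ = x); last by field; rewrite gt_eqF.
  rewrite (_ : _ * l + _ = f x); last by rewrite /f; field; rewrite gt_eqF.
  apply; rewrite ler_pdivrMr// divr_ge0/=; lra.
Qed.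

Lemma slab_cat a b c : a <= b -> b <= c -> slab a c = (slab a b + slab b c)%E.
Proof.
move=> ab bc; rewrite /slab.
have E : `]a, c]%classic = (`]a, b] `|` `]b, c])%classic.
  by apply: itv_bndbnd_setU; rewrite bnd_simp.
rewrite E ge0_integral_setU//.
- by apply: measurable_funTS; exact: measurable_fun_xsection.
- apply/disj_setPS => t [/=]; rewrite !in_itv/= => /andP[_ h1] /andP[h2 _].
  by move: (lt_le_trans h2 h1); rewrite ltxx.
Qed.

Lemma slab_le_area a b : (slab a b <= area S)%E.
Proof.
rewrite /area /product_measure1; apply: ge0_subset_integral => //.
exact: measurable_fun_xsection.
Qed.

End StripArea.

(** * The normalised trapezoid *)

Section CopiesArea.
Variable R : realType.
Implicit Types (T : set (pt2 R)) (k m s : R).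

Lemma has_copy_le T r1 r2 m s : convex2 T -> 0 <= m <= s -> has_copy T r1 r2 s ->
  has_copy T r1 r2 m.
Proof.
move=> cT /andP[m0 ms] [p [Tp T1 T2]].
have [s0|s0] := leP s 0.
  have -> : m = s by lra.
  by exists p.
have ms01 : 0 <= m / s <= 1.
  by apply/andP; split; [rewrite divr_ge0// ltW|rewrite ler_pdivrMr// mul1r].
exists p; split => //.
  have -> : add2 p (scale2 m r1) =
      add2 (scale2 (m / s) (add2 p (scale2 s r1))) (scale2 (1 - m / s) p).
    by rewrite /add2 /scale2/=; congr (_, _); field; rewrite gt_eqF.
  exact: cT.
have -> : add2 p (scale2 m r2) =
    add2 (scale2 (m / s) (add2 p (scale2 s r2))) (scale2 (1 - m / s) p).
  by rewrite /add2 /scale2/=; congr (_, _); field; rewrite gt_eqF.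
exact: cT.
Qed.

(** The known chord lengths are [m] at [x0], [m * k] at [x1] and [x2], and [0] at the apices
    [x1 - m] and [x2 + m]; in each configuration the area under an interpolation suffices. Let [W]
    be the distance between the apices. If [x0] lies between them, two triangles on the chord [m]
    have area [m W / 2], enough when [W >= 2 m / (2 - k)]. For smaller [W] the apices are close, so
    the bases are far apart ([x2 < x1]) and contribute. *)
Lemma copies_area T k m : convex2 T -> closed T -> 0 <= k <= 1 -> 0 < m ->
  has_copy T (0, 1) (0, 1) m -> has_copy T (-1, 0) (0, k) m ->
  has_copy T (1, k) (0, k) m -> ((m ^+ 2 / (2 - k))%:E <= area T)%E.
Proof.
move=> cT clT /andP[k0 k1] m0 [[x0 y0] [c1 c2 _]] [[x1 y1] [d1 d2 d3]]
  [[x2 y2] [e1 e2 e3]].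
have mT := closed_measurable2 clT.
rewrite /add2 /scale2/= ?mulr0 ?addr0 ?mulr1 in c1 c2 d1 d2 d3 e1 e2 e3.
have C0 : chord T x0 m by exists y0.
have C1 : chord T x1 (m * k) by exists y1.
have C2 : chord T x2 (m * k) by exists y2.
have CA : chord T (x1 - m) 0 by exists y1; rewrite ?addr0; rewrite mulrN1 in d2.
have CB : chord T (x2 + m) 0 by exists (y2 + m * k); rewrite ?addr0.
have k2 : 0 < 2 - k by lra.
have mk0 : 0 <= m * k by rewrite mulr_ge0// ltW.
have m0' := ltW m0.
have cat a b c v w : a <= b -> b <= c -> (v%:E <= slab T a b)%E ->
    (w%:E <= slab T b c)%E -> ((v + w)%:E <= slab T a c)%E.
  by move=> ab bc va wb; rewrite (slab_cat mT ab bc) EFinD; exact: leeD.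
have fin v a b : (v%:E <= slab T a b)%E -> m ^+ 2 <= v * (2 - k) ->
    ((m ^+ 2 / (2 - k))%:E <= area T)%E.
  move=> h1 h2; apply: le_trans (slab_le_area mT a b); apply: le_trans h1.
  by rewrite lee_fin ler_pdivrMr.
have sl a b l l' : a <= b -> 0 <= l -> 0 <= l' -> chord T a l -> chord T b l' ->
  (((b - a) * (l + l') / 2)%:E <= slab T a b)%E by exact: slab_ge.
have kk : 0 <= k * (1 - k) by rewrite mulr_ge0//; lra.
have mm : 0 < m ^+ 2 by rewrite exprn_gt0.
(* [(1 + k) * (2 - k) = 2 + k * (1 - k)] is at least [2]. *)
have wide v : m * (m + m * k) / 2 <= v -> m ^+ 2 <= v * (2 - k).
  move=> hv; apply: (@le_trans _ _ (m * (m + m * k) / 2 * (2 - k))).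
    have -> : m * (m + m * k) / 2 * (2 - k) = m ^+ 2 + m ^+ 2 * (k * (1 - k)) / 2.
      by field.
    by rewrite lerDl divr_ge0// mulr_ge0// ltW.
  by rewrite ler_pM2r.
have mmk : 0 <= m + m * k by lra.
have [x01|x01] := leP (x0 + m) x1.
  apply: fin (sl x0 x1 m (m * k) _ _ _ C0 C1) _ => //; first lra.
  by apply: wide; rewrite ler_pM2r// ler_wpM2r//; lra.
have [x20|x20] := leP (x2 + m) x0.
  apply: fin (sl x2 x0 (m * k) m _ _ _ C2 C0) _ => //; first lra.
  by apply: wide; rewrite (addrC (m * k)) ler_pM2r// ler_wpM2r//; lra.
have [W|W] := leP (2 * m / (2 - k)) (x2 + m - (x1 - m)).
  apply: (fin _ _ _ (cat _ _ _ _ _ _ _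
    (sl (x1 - m) x0 0 m _ _ _ CA C0) (sl x0 (x2 + m) m 0 _ _ _ C0 CB))) => //; try lra.
  by move: W; rewrite ler_pdivrMr// => W; nra.
have W' : (x2 + m - (x1 - m)) * (2 - k) < 2 * m by rewrite -ltr_pdivlMr.
have x21 : x2 < x1 by nra.
have [x02|x02] := ltP x0 x2.
  apply: (fin _ _ _ (cat _ _ _ _ _ _ _
    (cat _ _ _ _ _ _ _ (sl (x1 - m) x0 0 m _ _ _ CA C0)
       (sl x0 x1 m (m * k) _ _ _ C0 C1))
    (sl x1 (x2 + m) (m * k) 0 _ _ _ C1 CB))) => //; try lra.
  by apply: wide; nra.
have [x10|x10] := ltP x1 x0.
  apply: (fin _ _ _ (cat _ _ _ _ _ _ _
    (cat _ _ _ _ _ _ _ (sl (x1 - m) x2 0 (m * k) _ _ _ CA C2)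
       (sl x2 x0 (m * k) m _ _ _ C2 C0))
    (sl x0 (x2 + m) m 0 _ _ _ C0 CB))) => //; try lra.
  by apply: wide; nra.
have [Wm|Wm] := leP m (x2 + m - (x1 - m)); last first.
  apply: (fin _ _ _ (cat _ _ _ _ _ _ _ (sl x2 x0 (m * k) m _ _ _ C2 C0)
       (sl x0 x1 m (m * k) _ _ _ C0 C1))) => //.
  by apply: wide; nra.
(* The four pieces add up to [m^2 - m W (1 - k) / 2], which exceeds the bound because
   [W < 2 m / (2 - k)]. *)
apply: (fin _ _ _ (cat _ _ _ _ _ _ _ (cat _ _ _ _ _ _ _
  (sl (x1 - m) x2 0 (m * k) _ _ _ CA C2) (sl x2 x0 (m * k) m _ _ _ C2 C0))
  (cat _ _ _ _ _ _ _ (sl x0 x1 m (m * k) _ _ _ C0 C1)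
     (sl x1 (x2 + m) (m * k) 0 _ _ _ C1 CB)))) => //; try lra.
rewrite [X in X * _](_ : _ = m ^+ 2 - m * (x2 + m - (x1 - m)) * (1 - k) / 2); last by field.
have := @ler_wpM2l _ (m * (1 - k)) _ _ _ (ltW W').
by rewrite mulr_ge0//; [move=> /(_ isT); lra|lra].
Qed.

End CopiesArea.

(** * Short billiard trajectories in the normalised trapezoid *)

Section NormalisedTrapezoid.
Variable R : realType.
Implicit Types (Q T : set (pt2 R)) (p q n r w : pt2 R).

Definition billiard Q T (A : R) := exists q1 q2 q3 p1 p2 p3,
  [/\ Q q1, Q q2 & Q q3] /\ [/\ T p1, T p2 & T p3] /\
  [/\ normal_cone T p1 (sub2 q2 q1), normal_cone T p2 (sub2 q3 q2) &
      normal_cone T p3 (sub2 q1 q3)] /\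
  [/\ normal_cone Q q1 (sub2 p3 p1), normal_cone Q q2 (sub2 p1 p2) &
      normal_cone Q q3 (sub2 p2 p3)] /\
  A = dot2 (sub2 q2 q1) p1 + dot2 (sub2 q3 q2) p2 + dot2 (sub2 q1 q3) p3.

(** The parallel sides are horizontal, of lengths [1] and [1 - k]; [k = 0] is the square and [k = 1]
    a triangle. *)
Definition unit_trapezoid (k : R) : set (pt2 R) :=
  [set q | [/\ 0 <= q.1, q.1 + k * q.2 <= 1, 0 <= q.2 & q.2 <= 1]].

(** The trajectory runs back and forth between the parallel sides in the direction [(nu, 1)].
    Testing the supporting lines of [T] on the triangle of size [s >= L] gives [-1 <= nu <= 1 - k],
    which makes such a segment fit. *)
Lemma chord_billiard k T L s p n1 n2 : 0 <= k <= 1 -> 0 < L -> L <= s ->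
  T p -> T (add2 p (scale2 L (0, 1))) ->
  normal_cone T (add2 p (scale2 L (0, 1))) n1 ->
  normal_cone T (add2 p (scale2 L (0, 1))) n2 ->
  normal_cone T p (scale2 (-1) (add2 n1 n2)) ->
  dot2 n1 (0, 1) + dot2 n2 (0, 1) = 1 ->
  has_copy T (-1, 0) (0, k) s -> billiard (unit_trapezoid k) T L.
Proof.
move=> /andP[k0 k1] L0 Ls Tp; set p2 := add2 _ _ => Tp2 N1 N2 N0 n12 [c [Tc Tc1 Tc2]].
have n2e : n1.2 + n2.2 = 1 by move: n12; rewrite /dot2/=; lra.
pose nu := n1.1 + n2.1.
have Np2 x : T x -> nu * x.1 + x.2 <= nu * p.1 + p.2 + L.
  move=> Tx; have := N1 _ Tx; have := N2 _ Tx.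
  by rewrite /dot2 /p2 /add2 /scale2/= /nu; nra.
have Np x : T x -> nu * p.1 + p.2 <= nu * x.1 + x.2.
  by move=> Tx; have := N0 _ Tx; rewrite /dot2 /add2 /scale2/= /nu; nra.
have nu1 : nu + k <= 1.
  have := Np2 _ Tc2; have := Np _ Tc1; rewrite /add2 /scale2/= => h1 h2.
  have : s * (nu + k) <= s * 1 by lra.
  by rewrite ler_pM2l//; lra.
have nu2 : -1 <= nu.
  have := Np2 _ Tc1; have := Np _ Tc; rewrite /add2 /scale2/= => h1 h2.
  have : s * (-1) <= s * nu by lra.
  by rewrite ler_pM2l//; lra.
(* The leftmost start on the bottom side for which the end point is not to the left of [0]. *)
pose x := if 0 <= nu then 0 else - nu.
have [x0 [x1 x2]] : 0 <= x /\ x <= 1 /\ (0 <= x + nu /\ x + nu + k <= 1).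
  by rewrite /x; case: (leP 0 nu) => h; lra.
exists (x, 0), (x + nu, 1), (x, 0), p2, p, p.
split; first by split; rewrite /unit_trapezoid/=; split; lra.
split; first by split.
split.
  split => y Ty.
  - have := Np2 _ Ty; rewrite /dot2 /sub2 /p2 /add2 /scale2/=; lra.
  - have := Np _ Ty; rewrite /dot2 /sub2 /=; lra.
  - rewrite /dot2 /sub2 /=; lra.
split.
  split => y [y1 y2 y3 y4]; rewrite /dot2 /sub2 /p2 /add2 /scale2/=; nra.
rewrite /dot2 /sub2 /p2 /add2 /scale2/=; ring.
Qed.

(** With [v] and [u] the vertical components of the normals [n1] and [n2], the three numbers are the
    heights of [q1], [q2], [q3]. For [k > 0] the point [q2] must lie on the bottom side, and the
    signs of [u] and [v + u] make it the lowest; for [k = 0] only the total height matters. *)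
Lemma lowest_height (k u v : R) : 0 <= k ->
  v + u <= 1 -> - (v + u) <= 1 -> v <= 1 -> - v <= 1 -> u <= 1 -> - u <= 1 ->
  0 <= k * u -> 0 <= k * (v + u) ->
  exists y, [/\ 0 <= y, 0 <= y - (v + u) & 0 <= y - v] /\
    [/\ y <= 1, y - (v + u) <= 1 & y - v <= 1] /\ k * (y - (v + u)) = 0.
Proof.
move=> k0 h1 h2 h3 h4 h5 h6 ku kvu; have [k00|kpos] := eqVneq k 0.
  rewrite k00.
  have [a1|a1] := leP (v + u) 0; have [a2|a2] := leP v 0.
  - by exists 0; split; [split; lra|split; [split; lra|lra]].
  - by exists v; split; [split; lra|split; [split; lra|lra]].
  - by exists (v + u); split; [split; lra|split; [split; lra|lra]].
  - have [a3|a3] := leP 0 u.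
      by exists (v + u); split; [split; lra|split; [split; lra|lra]].
    by exists v; split; [split; lra|split; [split; lra|lra]].
have kp : 0 < k by rewrite lt_neqAle eq_sym kpos.
rewrite pmulr_rge0// in ku; rewrite pmulr_rge0// in kvu.
by exists (v + u); rewrite subrr mulr0; split; [split; lra|split; [split; lra|]].
Qed.

(* [w1] and [w3] are the outer normals of the two legs, in either order. *)
Lemma triangle_billiard Q T k e b1 b3 w1 w3 s L p n1 n2 : convex_body2 T ->
  (forall q, Q q <-> [/\ dot2 w1 q <= b1, dot2 w3 q <= b3, 0 <= q.2 & q.2 <= 1]) ->
  w1.1 = e -> w3.1 = - e -> w1.2 + w3.2 = k -> b1 + b3 = 1 ->
  e ^+ 2 = 1 -> 0 <= k -> 0 < s -> s <= L ->
  T p -> T (add2 p (scale2 s w1)) -> T (add2 p (scale2 s (0, k))) ->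
  normal_cone T (add2 p (scale2 s w1)) n1 ->
  normal_cone T (add2 p (scale2 s (0, k))) n2 ->
  normal_cone T p (scale2 (-1) (add2 n1 n2)) ->
  dot2 n1 w1 + dot2 n2 (0, k) = 1 ->
  has_copy T (0, 1) (0, 1) L -> billiard Q T s.
Proof.
move=> bT HQ w1e w3e wk b13 e1 k0 s0 sL Tp1; set p3 := add2 p (scale2 s w1).
set p2 := add2 p (scale2 s (0, k)) => Tp3 Tp2 N3 N2 N1 n12 [c [Tc Tc1 _]].
have L0 : 0 < L by lra.
(* Weak duality: on triples of [T] the functional given by the three normals is at most its value
   [s] at the inscribed triangle. *)
have key x1 x2 x3 : T x1 -> T x2 -> T x3 ->
    dot2 (scale2 (-1) (add2 n1 n2)) x1 + dot2 n2 x2 + dot2 n1 x3 <= s.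
  move=> /N1 h1 /N2 h2 /N3 h3.
  have : dot2 (scale2 (-1) (add2 n1 n2)) p + dot2 n2 p2 + dot2 n1 p3
      = s * (dot2 n1 w1 + dot2 n2 (0, k)).
    by rewrite /dot2 /scale2 /add2 /p2 /p3 /add2 /scale2/=; ring.
  by rewrite n12 mulr1 => <-; lra.
have small (t : R) : L * t <= s -> t <= 1.
  by move=> h; rewrite -(ler_pM2l L0) mulr1; lra.
(* Distributing the two ends of the chord of length [L >= s] over the three arguments in all six
   nonconstant ways shows that no side of the polygon is taller than [Q]. *)
have := key _ _ _ Tc1 Tc Tc; have := key _ _ _ Tc Tc1 Tc.
have := key _ _ _ Tc Tc Tc1; have := key _ _ _ Tc1 Tc1 Tc.
have := key _ _ _ Tc1 Tc Tc1; have := key _ _ _ Tc Tc1 Tc1.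
rewrite /dot2 /scale2 /add2/= => t1 t2 t3 t4 t5 t6.
have {t1} t1 : n1.2 + n2.2 <= 1 by apply: small; lra.
have {t2} t2 : - n2.2 <= 1 by apply: small; lra.
have {t3} t3 : - n1.2 <= 1 by apply: small; lra.
have {t4} t4 : n1.2 <= 1 by apply: small; lra.
have {t5} t5 : n2.2 <= 1 by apply: small; lra.
have {t6} t6 : - (n1.2 + n2.2) <= 1 by apply: small; lra.
(* Comparing each normal at its own vertex with the other two vertices gives these signs, which
   later place the [q_i] on the right side of the legs. *)
have u1 : 0 <= k * n2.2.
  have := N2 _ Tp1; rewrite /dot2 /p2 /add2 /scale2/= => h.
  by rewrite -(pmulr_rge0 _ s0); lra.
have u2 : 0 <= k * (n1.2 + n2.2).
  have := N1 _ Tp2; rewrite /dot2 /p2 /add2 /scale2/= => h.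
  by rewrite -(pmulr_rge0 _ s0); lra.
have v1 : 0 <= dot2 w1 (add2 n1 n2).
  have := N1 _ Tp3; rewrite /dot2 /p3 /add2 /scale2/= => h.
  by rewrite -(pmulr_rge0 _ s0); lra.
have v2 : 0 <= dot2 w1 n1.
  have := N3 _ Tp1; rewrite /dot2 /p3 /add2 /scale2/= => h.
  by rewrite -(pmulr_rge0 _ s0); lra.
have v3 : 0 <= dot2 w3 n2.
  have := N2 _ Tp3; rewrite /dot2 /p3 /p2 /add2 /scale2/= -wk w3e w1e => h.
  by rewrite -(pmulr_rge0 _ s0); lra.
have v4 : dot2 w3 n1 <= 0.
  have := N3 _ Tp2; rewrite /dot2 /p3 /p2 /add2 /scale2/= -wk w3e w1e => h.
  by rewrite -(pmulr_rle0 _ s0); lra.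
have [y [[y1 y2 y3] [[y4 y5 y6] ky]]] := lowest_height k0 t1 t6 t4 t3 t5 t2 u1 u2.
(* Puts [q1] on the leg with normal [w1]; as [e ^+ 2 = 1], multiplication by [e] inverts itself. *)
pose x := e * (b1 - w1.2 * y).
have ex : e * x = b1 - w1.2 * y by rewrite /x mulrA -expr2 e1 mul1r.
pose q1 : pt2 R := (x, y).
pose q2 : pt2 R := (x - (n1.1 + n2.1), y - (n1.2 + n2.2)).
pose q3 : pt2 R := (x - n1.1, y - n1.2).
have E1 : dot2 w1 q1 = b1 by rewrite /dot2 /q1/= w1e ex; ring.
(* The normalisation of the normals, together with [b1 + b3 = 1] and [ky], puts [q3] on the other
   leg. *)
have E3 : dot2 w3 q3 = b3.
  move: n12; rewrite /dot2 /q3/= w1e w3e => n12.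
  have -> : b3 = 1 - b1 by lra.
  have -> : - e * (x - n1.1) + w3.2 * (y - n1.2) =
    - (e * x) + (n1.1 * e + n1.2 * w1.2 + (n2.1 * 0 + n2.2 * k))
      + (w3.2 * y - (w1.2 + w3.2) * n1.2 - n2.2 * k) by ring.
  by rewrite n12 ex wk -[RHS]addr0 -ky -wk; ring.
have f1 : dot2 w1 q2 = b1 - dot2 w1 (add2 n1 n2).
  by rewrite -E1 /dot2 /q1 /q2 /add2/=; ring.
have f2 : dot2 w1 q3 = b1 - dot2 w1 n1 by rewrite -E1 /dot2 /q1 /q3/=; ring.
have f3 : dot2 w3 q2 = b3 - dot2 w3 n2 by rewrite -E3 /dot2 /q2 /q3/=; ring.
have f4 : dot2 w3 q1 = b3 + dot2 w3 n1 by rewrite -E3 /dot2 /q1 /q3/=; ring.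
exists q1, q2, q3, p, p2, p3.
split; first by split; apply/HQ; rewrite ?E1 ?E3 ?f1 ?f2 ?f3 ?f4; split => //=; lra.
split; first by [].
split.
  split.
  - by rewrite (_ : sub2 q2 q1 = scale2 (-1) (add2 n1 n2))//
      /sub2 /scale2 /add2/=; congr (_, _); ring.
  - rewrite (_ : sub2 q3 q2 = n2)// [RHS]surjective_pairing /sub2/=.
    by congr (_, _); ring.
  - rewrite (_ : sub2 q1 q3 = n1)// [RHS]surjective_pairing /sub2/=.
    by congr (_, _); ring.
split.
  split => q /HQ[h1 h2 h3 h4].
  - have -> : sub2 p3 p = scale2 s w1.
      by rewrite /sub2 /p3 /add2 /scale2/=; congr (_, _); ring.
    have dz z : dot2 (scale2 s w1) z = s * dot2 w1 z by rewrite /dot2 /scale2/=; ring.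
    by rewrite !dz E1 ler_pM2l.
  - have -> : sub2 p p2 = (0, - (s * k)).
      by rewrite /sub2 /p2 /add2 /scale2/=; congr (_, _); ring.
    have dz z : dot2 (0, - (s * k)) z = - (s * (k * z.2)) by rewrite /dot2/=; ring.
    by rewrite !dz ky mulr0 oppr0 oppr_le0 !mulr_ge0// ltW.
  - have -> : sub2 p2 p3 = scale2 s w3.
      rewrite /sub2 /p3 /p2 /add2 /scale2/= -wk w3e w1e; congr (_, _); ring.
    have dz z : dot2 (scale2 s w3) z = s * dot2 w3 z by rewrite /dot2 /scale2/=; ring.
    by rewrite !dz E3 ler_pM2l.
have -> : s = s * (dot2 n1 w1 + dot2 n2 (0, k)) by rewrite n12 mulr1.
rewrite /dot2 /sub2 /p2 /p3 /add2 /scale2/=; ring.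
Qed.

(** [A] is the smallest of the three sizes: its polygon fits, and copies of all three figures of
    size [A] lie in [T]. The two triangles differ by the order of the legs in [HQ1] and [HQ2]. *)
Lemma unit_trapezoid_billiard k T : 0 <= k <= 1 -> convex_body2 T ->
  exists A, [/\ 0 < A, billiard (unit_trapezoid k) T A &
    ((A ^+ 2 / (2 - k))%:E <= area T)%E].
Proof.
move=> k01 bT; have [_ clT cT _] := convex_bodyP bT.
have /andP[k0 k1] := k01.
have nz (p : pt2 R) : p.1 != 0 \/ p.2 != 0 -> p <> 0.
  by case=> /eqP h E; apply: h; rewrite E.
have nz1 : (0, 1) <> 0 :> pt2 R by apply: nz; right; rewrite oner_neq0.
have nz2 : (-1, 0) <> 0 :> pt2 R by apply: nz; left; rewrite oppr_eq0 oner_neq0.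
have nz3 : (1, k) <> 0 :> pt2 R by apply: nz; left; rewrite oner_neq0.
have [L [p [m1 [m2 [[L0 Tp Tp1 Tp2] [N1 N2 N0 N]]]]]] := inscribed_copy (0, 1) bT nz1.
have [s [a [n1 [n2 [[s0 Ta Ta1 Ta2] [S1 S2 S0 S]]]]]] := inscribed_copy (0, k) bT nz2.
have [t [b [l1 [l2 [[t0 Tb Tb1 Tb2] [U1 U2 U0 U]]]]]] := inscribed_copy (0, k) bT nz3.
have cL : has_copy T (0, 1) (0, 1) L by exists p.
have cs : has_copy T (-1, 0) (0, k) s by exists a.
have ct : has_copy T (1, k) (0, k) t by exists b.
have main m : 0 < m -> m <= L -> m <= s -> m <= t ->
    ((m ^+ 2 / (2 - k))%:E <= area T)%E.
  move=> m0 mL ms mt; apply: copies_area => //.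
  - by apply: has_copy_le cL => //; rewrite ltW.
  - by apply: has_copy_le cs => //; rewrite ltW.
  - by apply: has_copy_le ct => //; rewrite ltW.
have HQ1 q : unit_trapezoid k q <->
    [/\ dot2 (-1, 0) q <= 0, dot2 (1, k) q <= 1, 0 <= q.2 & q.2 <= 1].
  by rewrite /unit_trapezoid /dot2/=; split => -[? ? ? ?]; split; lra.
have HQ2 q : unit_trapezoid k q <->
    [/\ dot2 (1, k) q <= 1, dot2 (-1, 0) q <= 0, 0 <= q.2 & q.2 <= 1].
  by rewrite /unit_trapezoid /dot2/=; split => -[? ? ? ?]; split; lra.
have [Ls|sL] := leP L s; have [Lt|tL] := leP L t.
- exists L; split; [by []| |exact: main].
  by apply: (chord_billiard (s := s)) N1 N2 N0 N _.
- exists t; split; [by []| |by apply: main => //; lra].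
  by apply: (triangle_billiard (L := L) bT HQ2) U1 U2 U0 U _ => //=; lra.
- exists s; split; [by []| |by apply: main => //; lra].
  by apply: (triangle_billiard (L := L) bT HQ1) S1 S2 S0 S _ => //=; lra.
- have [st|ts] := leP s t.
    exists s; split; [by []| |by apply: main => //; lra].
    by apply: (triangle_billiard (L := L) bT HQ1) S1 S2 S0 S _ => //=; lra.
  exists t; split; [by []| |by apply: main => //; lra].
  by apply: (triangle_billiard (L := L) bT HQ2) U1 U2 U0 U _ => //=; lra.
Qed.

End NormalisedTrapezoid.

(** * Nonnegativity of the action *)

Section NonnegativeAction.
Variable R : realType.
Import HBNNSimple.

(** The integrand will come from an arbitrary closed characteristic, so the argument goes through
    the simple functions in the definition of the integral: one below the positive part vanishes off
    a null set. *)
Lemma Rintegral_ae_le0 (D N : set R) (f : R -> R) :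
  (@lebesgue_measure R).-negligible N ->
  (forall t, D t -> ~ N t -> f t <= 0) ->
  Rintegral (@lebesgue_measure R) D f <= 0.
Proof.
move=> [N' [mN' N'0 NN']] f0.
rewrite /Rintegral; apply: fine_le0.
rewrite /integral; set g := (fun t => (f t)%:E) \_ D.
set u := (X in (X - _)%E); set v := (X in (_ - X)%E).
have v0 : (0 <= v)%E.
  apply: ereal_sup_ubound; exists (cst_nnsfun _ (@NngNum R 0 (lexx 0))) => /=.
    by move=> t /=; exact: funeneg_ge0.
  exact: sintegral0.
suff -> : u = 0%E by rewrite sub0e oppe_le0.
apply/eqP; rewrite eq_le; apply/andP; split.
  apply: ub_ereal_sup => _ [h hg <-].
  rewrite sintegralE fsbig1// => r _.
  have [->|r0] := eqVneq r 0; first by rewrite mul0e.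
  suff M0 : (@lebesgue_measure R) (h @^-1` [set r]) = 0%E.
    by rewrite [X in (_ * X)%E]M0 mule0.
  apply/eqP; rewrite eq_le measure_ge0 andbT -N'0; apply: le_measure; rewrite ?inE//.
  move=> t /= ht; apply: NN'; apply: contrapT => Nt.
  have := hg t; rewrite funeposE /g patchE.
  have h0 : 0 < h t by rewrite lt_neqAle eq_sym ht r0 -ht; exact: fun_ge0.
  case: ifPn => [/set_mem Dt|_].
    rewrite max_r; first by rewrite lee_fin leNgt h0.
    by rewrite lee_fin; exact: f0.
  by rewrite maxxx lee_fin leNgt h0.
apply: ereal_sup_ubound; exists (cst_nnsfun _ (@NngNum R 0 (lexx 0))) => /=.
  by move=> t /=; exact: funepos_ge0.
exact: sintegral0.
Qed.

Lemma gauge0_le (C : set (pt4 R)) : C !=set0 -> gauge C ((0, 0), (0, 0)) <= 0.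
Proof.
move=> [c Cc]; apply: ge_inf; first by exists 0 => t [].
by split => //; exists c; split => //; rewrite /scale4 !mul0r.
Qed.

(** The subgradient inequality tested at the origin gives [ip4 v (x t) >= 1], and [J4] applied twice
    is minus the identity, so the integrand is negative almost everywhere. *)
Lemma action_ge0 (C : set (pt4 R)) x : C !=set0 -> closed_characteristic C x ->
  0 <= action x.
Proof.
move=> C0 [_ [g1 [N [N0 H]]]].
rewrite /action mulNr oppr_ge0 pmulr_rle0; last by lra.
apply: Rintegral_ae_le0 N0 _ => t t01 Nt.
have [_ [lam [v [lam0 [sv ->]]]]] := H t t01 Nt.
have := sv ((0, 0), (0, 0)); have := gauge0_le C0; rewrite (g1 t).
rewrite /ip4 /sub4 /J4 /scale4/= => h1 h2.
set s := (X in X <= 0).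
have -> : s = lam * ((v.1.1 * (0 - (x t).1.1) + v.1.2 * (0 - (x t).1.2) +
  v.2.1 * (0 - (x t).2.1) + v.2.2 * (0 - (x t).2.2))) by rewrite /s; ring.
by rewrite pmulr_rle0//; lra.
Qed.

End NonnegativeAction.

(** * Affine normalisation *)

Section TrapezoidCoordinates.
Variable R : realType.
Implicit Types (Q T : set (pt2 R)) (a e f p q z : pt2 R).

Definition frame a e f z : pt2 R :=
  (e.1 * z.1 + f.1 * z.2 + a.1, e.2 * z.1 + f.2 * z.2 + a.2).

Definition frame_det e f : R := e.1 * f.2 - f.1 * e.2.

(** The transpose of the linear part of [frame]; moving positions by [frame] and momenta by the
    inverse of [coframe] is symplectic. *)
Definition coframe e f p : pt2 R := (dot2 e p, dot2 f p).

Definition coframe_inv e f p : pt2 R :=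
  (f.2 / frame_det e f * p.1 + (- e.2 / frame_det e f) * p.2 + 0,
   (- f.1 / frame_det e f) * p.1 + e.1 / frame_det e f * p.2 + 0).

Lemma coframeK e f : frame_det e f != 0 -> cancel (coframe e f) (coframe_inv e f).
Proof.
move=> D0 [x y]; rewrite /coframe_inv /coframe /dot2/=.
by congr (_, _); move: D0; rewrite /frame_det => D0; field.
Qed.

Lemma coframe_invK e f : frame_det e f != 0 -> cancel (coframe_inv e f) (coframe e f).
Proof.
move=> D0 [x y]; rewrite /coframe_inv /coframe /dot2/=.
by congr (_, _); move: D0; rewrite /frame_det => D0; field.
Qed.

Definition frame_inv a e f q : pt2 R :=
  ((f.2 * (q.1 - a.1) - f.1 * (q.2 - a.2)) / frame_det e f,
   (- e.2 * (q.1 - a.1) + e.1 * (q.2 - a.2)) / frame_det e f).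

Lemma frameK a e f : frame_det e f != 0 ->
  cancel (frame a e f) (frame_inv a e f).
Proof.
move=> D0 [x y]; rewrite /frame_inv /frame/=.
by congr (_, _); move: D0; rewrite /frame_det => D0; field.
Qed.

Lemma frame_invK a e f : frame_det e f != 0 ->
  cancel (frame_inv a e f) (frame a e f).
Proof.
move=> D0 [x y]; rewrite /frame_inv /frame/=.
by congr (_, _); move: D0; rewrite /frame_det => D0; field.
Qed.

Lemma frame_dot2 a e f z w p :
  dot2 (sub2 (frame a e f z) (frame a e f w)) p = dot2 (sub2 z w) (coframe e f p).
Proof. by rewrite /dot2 /sub2 /frame /coframe /dot2/=; ring. Qed.

Lemma dot2_frame a e f x y z : dot2 (sub2 x y) (frame a e f z) =
  dot2 (sub2 x y) a + dot2 (sub2 (coframe e f x) (coframe e f y)) z.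
Proof. by rewrite /dot2 /sub2 /frame /coframe /dot2/=; ring. Qed.

Lemma billiard_frame a e f Q T P A : frame_det e f != 0 ->
  (forall z, Q (frame a e f z) <-> P z) ->
  billiard P [set w | T (coframe_inv e f w)] A -> billiard Q T A.
Proof.
move=> D0 HQ [q1 [q2 [q3 [p1 [p2 [p3 [[Q1 Q2 Q3] [[T1 T2 T3]
  [[N1 N2 N3] [[M1 M2 M3] ->]]]]]]]]]].
have K := coframe_invK D0.
exists (frame a e f q1), (frame a e f q2), (frame a e f q3).
exists (coframe_inv e f p1), (coframe_inv e f p2), (coframe_inv e f p3).
have cone z w p : normal_cone [set w | T (coframe_inv e f w)] p (sub2 z w) ->
    normal_cone T (coframe_inv e f p) (sub2 (frame a e f z) (frame a e f w)).
  move=> N y Ty; rewrite !frame_dot2 K; apply: N => /=; by rewrite coframeK.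
have cone' x y z : normal_cone P z (sub2 x y) ->
    normal_cone Q (frame a e f z) (sub2 (coframe_inv e f x) (coframe_inv e f y)).
  move=> N q; rewrite -(frame_invK a D0 q) => /HQ Pw.
  by rewrite !dot2_frame !K lerD2l; exact: N.
split; first by split; apply/HQ.
split; first by [].
split; first by split; exact: cone.
split; first by split; exact: cone'.
by rewrite !frame_dot2 !K.
Qed.

Lemma convex_body_coframe e f T : frame_det e f != 0 -> convex_body2 T ->
  convex_body2 [set w | T (coframe_inv e f w)].
Proof.
move=> D0 [cT [vT [b iT]]]; split; last split.
- rewrite (_ : [set w | _] = coframe e f @` T).
    apply: continuous_compact cT; apply: continuous_subspaceT.
    by rewrite /coframe /dot2; cont.
  apply/seteqP; split => [w /= Tw|_ [p Tp <-]] /=; last by rewrite coframeK.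
  by exists (coframe_inv e f w) => //; rewrite coframe_invK.
- move=> p q t Tp Tq t01 /=; rewrite (_ : coframe_inv _ _ _ =
    add2 (scale2 t (coframe_inv e f p)) (scale2 (1 - t) (coframe_inv e f q))).
    exact: vT.
  by rewrite /coframe_inv /add2 /scale2/=; congr (_, _); ring.
- exists (coframe e f b).
  have cc : continuous (coframe_inv e f : R * R -> R * R).
    by rewrite /coframe_inv; cont.
  by apply: (cc (coframe e f b)); rewrite coframeK.
Qed.

Lemma area_unit_trapezoid_ge (k : R) : 0 <= k <= 1 ->
  measurable (unit_trapezoid k : set (measurableTypeR R * measurableTypeR R)) ->
  (((2 - k) / 2)%:E <= area (unit_trapezoid k))%E.
Proof.
move=> /andP[k0 k1] mU.
have cU : convex2 (unit_trapezoid k).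
  move=> p q t [p1 p2 p3 p4] [q1 q2 q3 q4] /andP[t0 t1].
  rewrite /unit_trapezoid /add2 /scale2/=; split; nra.
have C0 : chord (unit_trapezoid k) 0 1.
  by exists 0; rewrite /unit_trapezoid/=; split; lra.
have C1 : chord (unit_trapezoid k) (1 - k) 1.
  by exists 0; rewrite /unit_trapezoid/=; split; lra.
have C2 : chord (unit_trapezoid k) 1 0.
  by exists 0; rewrite /unit_trapezoid/=; split; lra.
apply: le_trans (slab_le_area mU 0 1).
have ab : 0 <= 1 - k by lra.
have bc : 1 - k <= 1 by lra.
rewrite (slab_cat mU ab bc).
have h1 := slab_ge mU cU ab ler01 ler01 C0 C1.
have h2 := slab_ge mU cU bc ler01 (lexx 0) C1 C2.
apply: le_trans (leeD h1 h2).
by rewrite -EFinD lee_fin; lra.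
Qed.

Lemma closed_unit_trapezoid (k : R) : closed (unit_trapezoid k : set (R * R)).
Proof.
have ge0 (g : R * R -> R) : continuous g -> closed [set q | 0 <= g q].
  move=> cg; apply: (@preimage_closed _ _ g [set x | 0 <= x]); last exact: closed_ge.
  by move=> z _; exact: cg.
rewrite (_ : unit_trapezoid k = [set q | 0 <= q.1] `&`
  [set q | 0 <= 1 - (q.1 + k * q.2)] `&` [set q | 0 <= q.2] `&`
  [set q | 0 <= 1 - q.2]).
  apply: closedI; [apply: closedI; [apply: closedI|]|].
  - by apply: (ge0 (fun q => q.1)); cont.
  - by apply: (ge0 (fun q => 1 - (q.1 + k * q.2))); cont.
  - by apply: (ge0 (fun q => q.2)); cont.
  - by apply: (ge0 (fun q => 1 - q.2)); cont.
apply/seteqP; split => q /=; rewrite /unit_trapezoid/= !subr_ge0.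
  by case.
by case=> [[[]]].
Qed.

Lemma conv4_rev (a b c d : pt2 R) : conv4 a b c d = conv4 d c b a.
Proof.
apply/seteqP; split => _ [ta [tb [tc [td [[h1 h2 h3 h4 h5] ->]]]]];
  exists td, tc, tb, ta; (split; first by split => //; lra);
  by rewrite /add2 /scale2/=; congr (_, _); ring.
Qed.

Lemma convex2_conv4 (a b c d : pt2 R) : convex2 (conv4 a b c d).
Proof.
move=> _ _ t [ta [tb [tc [td [[h1 h2 h3 h4 h5] ->]]]]]
  [sa [sb [sc [sd [[g1 g2 g3 g4 g5] ->]]]]] /andP[t0 t1].
exists (t * ta + (1 - t) * sa), (t * tb + (1 - t) * sb),
  (t * tc + (1 - t) * sc), (t * td + (1 - t) * sd).
split; last by rewrite /add2 /scale2/=; congr (_, _); ring.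
have t1' : 0 <= 1 - t by lra.
split; rewrite ?addr_ge0 ?mulr_ge0//.
have -> : td = 1 - ta - tb - tc by lra.
have -> : sd = 1 - sa - sb - sc by lra.
by ring.
Qed.

Lemma conv4_frame (a b c d : pt2 R) (lam : R) : 0 <= lam <= 1 ->
  c.1 - d.1 = lam * (b.1 - a.1) -> c.2 - d.2 = lam * (b.2 - a.2) ->
  forall q, conv4 a b c d q <->
    exists2 z, unit_trapezoid (1 - lam) z & q = frame a (sub2 b a) (sub2 d a) z.
Proof.
move=> /andP[l0 l1] c1 c2 q.
have {}c1 : c.1 = d.1 + lam * (b.1 - a.1) by lra.
have {}c2 : c.2 = d.2 + lam * (b.2 - a.2) by lra.
split.
  move=> [ta [tb [tc [td [[h1 h2 h3 h4 h5] ->]]]]].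
  exists (tb + lam * tc, tc + td).
    by rewrite /unit_trapezoid/=; split; nra.
  have -> : ta = 1 - tb - tc - td by lra.
  by rewrite /frame /sub2 /add2 /scale2/= c1 c2; congr (_, _); ring.
move=> [[x y] [/= h1 h2 h3 h4] ->].
(* The diagonal from [a] to [c] is [x = lam * y]; the weights are those of the triangle [a, c, d] on
   one side and [a, b, c] on the other. For [lam = 0] the first case has [x = 0], matching
   [x / 0 = 0]. *)
have [xy|xy] := leP x (lam * y).
  have lx : lam * (x / lam) = x.
    have [l00|ln0] := eqVneq lam 0; last by rewrite mulrC divfK.
    by rewrite l00 mul0r; move: xy; rewrite l00 mul0r; lra.
  have xl : x / lam <= y.
    have [->|ln0] := eqVneq lam 0; first by rewrite invr0 mulr0.
    have lp : 0 < lam by rewrite lt_neqAle eq_sym ln0.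
    by rewrite ler_pdivrMr// mulrC.
  have w0 : 0 <= x / lam by exact: divr_ge0.
  move: (x / lam) lx xl w0 => w <- xl w0.
  exists (1 - y), 0, w, (y - w).
  split; first by split => //; lra.
  by rewrite /frame /sub2 /add2 /scale2/= c1 c2; congr (_, _); ring.
exists (1 - (x - lam * y) - y), (x - lam * y), y, 0.
split; first by split => //; lra.
by rewrite /frame /sub2 /add2 /scale2/= c1 c2; congr (_, _); ring.
Qed.

(** If [e] and [f] were dependent, [Q] would lie on a line with normal [n], yet an interior point
    can be moved along [n]. *)
Lemma frame_det_neq0 Q P a e f : interior Q !=set0 ->
  (forall q, Q q -> exists2 z, P z & q = frame a e f z) -> frame_det e f != 0.
Proof.
move=> [b iQ] H; apply/eqP => D0.
have [n n0 [ne nf]] : exists2 n : pt2 R, 0 < dot2 n n & dot2 n e = 0 /\ dot2 n f = 0.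
  have sq (x y : R) : x != 0 \/ y != 0 -> 0 < x * x + y * y.
    move=> xy; rewrite lt_neqAle addr_ge0 -?expr2 ?sqr_ge0// andbT eq_sym.
    rewrite paddr_eq0 ?sqr_ge0// !sqrf_eq0 negb_and.
    by case: xy => ->; rewrite ?orbT.
  have [e1|e1] := eqVneq e.1 0; last first.
    exists (- e.2, e.1); first by rewrite /dot2/=; apply: sq; right.
    by move: D0; rewrite /frame_det /dot2/=; split; lra.
  have [e2|e2] := eqVneq e.2 0; last first.
    exists (- e.2, e.1); first by rewrite /dot2/=; apply: sq; left; rewrite oppr_eq0.
    by move: D0; rewrite /frame_det /dot2/=; split; lra.
  have [f1|f1] := eqVneq f.1 0; last first.
    exists (- f.2, f.1); first by rewrite /dot2/=; apply: sq; right.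
    by rewrite /dot2 e1 e2/=; split; ring.
  exists (1, 0); first by rewrite /dot2/=; apply: sq; left; rewrite oner_neq0.
  by rewrite /dot2 e1 e2 f1/=; split; ring.
have [d d0 [/= Q1 _]] := interior_dir (n, n) (interior_setX iQ iQ).
have Qc q : Q q -> dot2 n q = dot2 n a.
  move=> /H[z _ ->]; transitivity (dot2 n a + z.1 * dot2 n e + z.2 * dot2 n f).
    by rewrite /dot2 /frame/=; ring.
  by rewrite ne nf !mulr0 !addr0.
have := Qc _ Q1; have := Qc _ (interior_subset iQ) => E1 E2.
have : d * dot2 n n = 0 by move: E1 E2; rewrite /dot2/=; lra.
by apply/eqP; rewrite mulf_neq0// gt_eqF.
Qed.

Lemma trapezoid_frame Q : trapezoid Q -> exists a e f k,
  [/\ 0 <= k <= 1, frame_det e f != 0 &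
    forall z, Q (frame a e f z) <-> unit_trapezoid k z].
Proof.
suff main (a b c d : pt2 R) (lam : R) : 0 <= lam <= 1 ->
    c.1 - d.1 = lam * (b.1 - a.1) -> c.2 - d.2 = lam * (b.2 - a.2) ->
    interior (conv4 a b c d) !=set0 -> exists a' e f k,
  [/\ 0 <= k <= 1, frame_det e f != 0 &
    forall z, conv4 a b c d (frame a' e f z) <-> unit_trapezoid k z].
  move=> [a [b [c [d [lam [l0 [c1 [c2 [-> iQ]]]]]]]]].
  have [l1|l1] := leP lam 1; first by apply: (main _ _ _ _ lam) iQ; rewrite ?l0.
  (* Reversing the vertices exchanges the parallel sides, so the longer one becomes the base and the
     ratio [lam] becomes its inverse. *)
  rewrite conv4_rev in iQ *; have lp : 0 < lam by lra.
  apply: (main _ _ _ _ lam^-1) iQ.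
  - by rewrite invr_ge0 l0/= invf_le1// ltW.
  - by rewrite c1 mulKf// gt_eqF.
  - by rewrite c2 mulKf// gt_eqF.
move=> l01 c1 c2 iQ.
have H := conv4_frame l01 c1 c2.
have D0 : frame_det (sub2 b a) (sub2 d a) != 0.
  apply: (frame_det_neq0 (P := unit_trapezoid (1 - lam)) (a := a) iQ) => q.
  by rewrite H.
exists a, (sub2 b a), (sub2 d a), (1 - lam); split => //.
  by move/andP: l01 => [? ?]; apply/andP; split; lra.
move=> z; split => [/H[w Pw /(can_inj (frameK a D0)) ->]//|Pz].
by apply/H; exists z.
Qed.

(** The determinant of the frame multiplies the area of [Q] and divides that of [T], and the factors
    [2 - k] cancel too. *)
Lemma trapezoid_vol_ge Q T : trapezoid Q -> convex_body2 T ->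
  exists A, [/\ 0 < A, billiard Q T A & ((A ^+ 2 / 2)%:E <= vol4 (Q `*` T))%E].
Proof.
move=> /trapezoid_frame[a [e [f [k [k01 D0 HQ]]]]] bT.
have [B [B0 bB aB]] := unit_trapezoid_billiard k01 (convex_body_coframe D0 bT).
exists B; split => //; first exact: billiard_frame bB.
have k2 : 0 < 2 - k by move/andP: k01 => [? ?]; lra.
have [_ clT _ _] := convex_bodyP bT.
have mU := closed_measurable2 (@closed_unit_trapezoid k).
have clQ : closed (Q : set (R * R)).
  rewrite (_ : Q = (frame_inv a e f : R * R -> R * R) @^-1` unit_trapezoid k).
    apply: preimage_closed; last exact: closed_unit_trapezoid.
    by move=> z _; move: z; rewrite /frame_inv; cont.
  by apply/seteqP; split => q /= Qq; [apply/HQ|rewrite -(frame_invK a D0 q); apply/HQ];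
    rewrite ?frame_invK.
have mQ := closed_measurable2 clQ; have mT := closed_measurable2 clT.
have D0' : 0 < `|frame_det e f| by rewrite normr_gt0.
have areaQ : ((`|frame_det e f| * ((2 - k) / 2))%:E <= area Q)%E.
  have [_ <-] := scales_area_affine a.1 a.2 D0; last exact: mQ.
  rewrite (_ : _ @^-1` Q = unit_trapezoid k); last first.
    by apply/seteqP; split => z /= /HQ.
  by rewrite EFinM; apply: lee_wpmul2l => //; exact: area_unit_trapezoid_ge.
have areaT : ((`|frame_det e f|^-1 * (B ^+ 2 / (2 - k)))%:E <= area T)%E.
  have D1 : f.2 / frame_det e f * (e.1 / frame_det e f) -
      (- e.2 / frame_det e f) * (- f.1 / frame_det e f) = (frame_det e f)^-1.
    by move: D0; rewrite /frame_det => D0; field.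
  have := @scales_area_affine R (f.2 / frame_det e f) (- e.2 / frame_det e f) 0
    (- f.1 / frame_det e f) (e.1 / frame_det e f) 0.
  rewrite D1 invr_eq0 => /(_ D0)[_ /(_ T mT) <-].
  by rewrite normfV EFinM; apply: lee_wpmul2l.
apply: le_trans (vol4_setX_ge mQ mT _ areaQ areaT).
  by rewrite lee_fin le_eqVlt; apply/orP; left; apply/eqP; field; rewrite !gt_eqF.
by rewrite mulr_ge0// ?invr_ge0// divr_ge0// ?sqr_ge0// ltW.
Qed.

End TrapezoidCoordinates.

(** * Viterbo's inequality for a trapezoid times a convex body *)

Unset Implicit Arguments.

Theorem theorem1p1 (R : realType) (Q T : set (pt2 R)) :
  trapezoid Q -> convex_body2 T ->
  forall c : R, is_cEHZ (Q `*` T) c ->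
  ((c ^+ 2 / 2)%:E <= vol4 (Q `*` T))%E.
Proof.
move=> tQ bT c [z0 [iz [[x [cx xc]] cmin]]].
have [A [A0 bA volA]] := trapezoid_vol_ge tQ bT.
apply: le_trans volA.
have [_ _ cT _] := convex_bodyP bT.
have cQ : convex2 Q.
  by move: tQ => [a [b [c' [d [lam [_ [_ [_ [-> _]]]]]]]]]; exact: convex2_conv4.
move: bA => [q1 [q2 [q3 [p1 [p2 [p3 [[Q1 Q2 Q3] [[T1 T2 T3]
  [[N1 N2 N3] [[M1 M2 M3] AE]]]]]]]]]].
have [|y [cy yA]] := billiard_closed_characteristic cQ cT iz Q1 Q2 Q3 T1 T2 T3
  N1 N2 N3 M1 M2 M3; first by rewrite -AE.
have cA : c <= A by rewrite AE -yA; exact: cmin.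
(* The bound [c <= A] passes to squares only for nonnegative [c]. *)
have c0 : 0 <= c.
  rewrite -xc; apply: (@action_ge0 _ (translate4 (Q `*` T) z0)) => //.
  by exists (sub4 z0 z0); exists z0 => //; exact: interior_subset.
by rewrite lee_fin ler_pM2r// ler_pXn2r// nnegrE ltW.
Qed.
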